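(* For semi-density matrices $\sigma$ and $\rho$ on $n$ qubits, relativized to an elementary unitary transform $A$, $\mathbf{d}(A\sigma A^*|A\rho A^* )=^{+}\mathbf{d}(\sigma|\rho)$.
   Context: $U$ is a fixed universal prefix Turing machine and $\mathbf{m}(x/y)=\sum_p 2^{-\|p\|}[U_y(p)=x]$ the universal probability. An object is elementary if its entries have rational real and imaginary parts. A program $q$ lower computes a positive semidefinite matrix $\sigma$ if $U(q)$ outputs an increasing sequence of elementary semi-density matrices converging to $\sigma$; $\underline{\mathbf{m}}(\sigma/x)=\sum\{\mathbf{m}(q/x): q\text{ lower computes }\sigma\}$. For a semi-density matrix $\rho$, a $\rho$-test is a lower computable matrix $\nu$ with $\mathrm{Tr}\,\nu\rho\le1$; $\mathcal{T}_\rho$ is the set of $\rho$-tests, $\mathfrak{T}_\rho=\sum_{\nu\in\mathcal{T}_\rho}\underline{\mathbf{m}}(\nu/n)\nu$, and the deficiency of randomness of $\sigma$ with respect to $\rho$ is $\mathbf{d}(\sigma|\rho)=\log\mathrm{Tr}\,\mathfrak{T}_\rho\sigma$. ''Relativized to $A$'' means $U$ gets an encoding of $A$ on an auxiliary tape. $=^{+}$ denotes equality up to an additive $O(1)$. *)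

(* Defs.v *)
From HB Require Import structures.
From mathcomp Require Import all_boot all_order all_algebra.
From mathcomp Require Import complex sesquilinear spectral.
From mathcomp Require Import all_classical all_reals all_analysis.
From mathcomp Require Import showcase.summability.

Set Implicit Arguments.
Unset Strict Implicit.
Unset Printing Implicit Defensive.

Import Order.TTheory GRing.Theory Num.Theory.
Import numFieldNormedType.Exports.

#[global] Open Scope classical_set_scope.
#[global] Open Scope ring_scope.
#[global] Open Scope complex_scope.
#[global] Open Scope sesquilinear_scope.

Inductive direction := Left | Stay | Right.

Definition displacement (d : direction) : int :=
  match d with Left => -1 | Stay => 0 | Right => 1 end.

(* A two-way infinite tape: head position and cell contents. *)
Definition tape (S : Type) : Type := (int * (int -> S))%type.

Definition scan S (t : tape S) : S := t.2 t.1.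

Definition write S (s : S) (t : tape S) : tape S :=
  (t.1, fun z => if z == t.1 then s else t.2 z).

Definition shift S (d : direction) (t : tape S) : tape S :=
  (t.1 + displacement d, t.2).

Definition string_tape (w : seq bool) : tape (option bool) :=
  (0, fun z => if z is Posz i then onth w i else None).

(* [Read f] consumes the next input bit [b] and goes to state [f b]: the input
   tape is one-way and has no end marker.  [Act q d1 d2 w o] goes to state [q],
   moves the heads of the two auxiliary tapes by [d1] and [d2], writes and moves
   on the work tapes as told by [w], and appends the bit [o], if any, to the
   write-only output. *)
Inductive action (Q S : Type) (k : nat) :=
  | Halt
  | Read of bool -> Q
  | Act of Q & direction & direction & {ffun 'I_k -> S * direction}
         & option bool.
Arguments Halt {Q S k}.

Record machine := Machine {
  state : finType;
  symbol : finType;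
  blank : symbol;
  ntapes : nat;
  start : state;
  (* arguments: the state, the symbols scanned on the auxiliary tapes holding
     the conditional string and the oracle string, those on the work tapes *)
  trans : state -> option bool -> option bool -> {ffun 'I_ntapes -> symbol} ->
          action state symbol ntapes }.

Record config (M : machine) := Config {
  cstate : state M;
  unread : seq bool;
  cond_tape : tape (option bool);
  oracle_tape : tape (option bool);
  work : 'I_(ntapes M) -> tape (symbol M);
  out : seq bool }.

Section Run.
Variable M : machine.

Definition next_action (c : config M) : action (state M) (symbol M) (ntapes M) :=
  trans (cstate c) (scan (cond_tape c)) (scan (oracle_tape c))
        [ffun i => scan (work c i)].

(* A halted configuration, or one that tries to read past the end of the input,
   is left unchanged. *)
Definition step (c : config M) : config M :=
  match next_action c with
  | Halt => c
  | Read f =>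
      if unread c is b :: w
      then Config (f b) w (cond_tape c) (oracle_tape c) (work c) (out c)
      else c
  | Act q d1 d2 w o =>
      Config q (unread c) (shift d1 (cond_tape c)) (shift d2 (oracle_tape c))
             (fun i => shift (w i).2 (write (w i).1 (work c i)))
             (out c ++ seq_of_opt o)
  end.

Definition init (a y p : seq bool) : config M :=
  Config (start M) p (string_tape y) (string_tape a)
         (fun=> (0, fun=> blank M)) [::].

(* the configuration reached after [t] steps on program [p], with [y] on the
   conditional tape and [a] on the oracle tape *)
Definition run (a y p : seq bool) (t : nat) : config M :=
  iter t step (init a y p).

(* M_y(p) = x relative to [a]: halting after reading exactly [p].  The set of
   halting programs is prefix-free because the input is read one way. *)
Definition computes (a y p x : seq bool) : Prop :=
  exists t, [/\ next_action (run a y p t) = Halt,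
                unread (run a y p t) = [::] & out (run a y p t) = x].

(* [w] is an initial segment of what M, halting or not, writes on [p]. *)
Definition emits (a y p w : seq bool) : Prop :=
  exists t, prefix w (out (run a y p t)).

(* M, run without conditional string, writes the infinite sequence of
   (self-delimiting) codewords [c 0], [c 1], ... *)
Definition outputs_sequence (a q : seq bool) (c : nat -> seq bool) : Prop :=
  forall k, emits a [::] q (flatten (mkseq c k)).

End Run.

(* Every machine is simulated, as to both its halting computations and its
   possibly endless output, by prefixing programs with a fixed string. *)
Definition universal (U : machine) : Prop :=
  forall T : machine, exists e : seq bool, forall a y p : seq bool,
    (forall x, computes T a y p x <-> computes U a y (e ++ p) x) /\
    (forall w, emits T a y p w <-> emits U a y (e ++ p) w).

(* Self-delimiting unary code; another computable code would change the
   deficiency by O(1) only. *)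
Definition nat_code (k : nat) : seq bool := rcons (nseq k true) false.

Definition int_code (z : int) : seq bool :=
  match z with
  | Posz k => false :: nat_code k
  | Negz k => true :: nat_code k
  end.

(* [(a, b, d)] stands for (a + b i) / (d + 1), not necessarily reduced. *)
Definition gauss_rat : Type := (int * int * nat)%type.

Definition gauss_rat_val (R : realType) (x : gauss_rat) : R[i] :=
  let: (a, b, d) := x in (a%:~R / d.+1%:R) +i* (b%:~R / d.+1%:R).

Definition gauss_rat_code (x : gauss_rat) : seq bool :=
  let: (a, b, d) := x in int_code a ++ int_code b ++ nat_code d.

Definition mx_val (R : realType) n (r : 'M[gauss_rat]_(2 ^ n)) :
    'M[R[i]]_(2 ^ n) :=
  \matrix_(i, j) gauss_rat_val R (r i j).

(* the number of qubits, then the entries in row-major order *)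
Definition mx_code n (r : 'M[gauss_rat]_(2 ^ n)) : seq bool :=
  nat_code n ++
  flatten [seq gauss_rat_code (r i j) | i <- enum 'I_(2 ^ n),
                                        j <- enum 'I_(2 ^ n)].

Definition encodes (R : realType) n (w : seq bool) (A : 'M[R[i]]_(2 ^ n)) :
    Prop :=
  exists2 r : 'M[gauss_rat]_(2 ^ n), mx_val R r = A & w = mx_code r.

Definition elementary (R : realType) m n (A : 'M[R[i]]_(m, n)) : Prop :=
  forall i j, exists p q : rat, A i j = ratr p +i* ratr q.

Definition psdmx (R : realType) n (A : 'M[R[i]]_n) : Prop :=
  A ^t* = A /\ forall u : 'rV[R[i]]_n, 0 <= (u *m A *m u ^t* ) 0 0.

Definition semi_density (R : realType) n (A : 'M[R[i]]_n) : Prop :=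
  psdmx A /\ \tr A <= 1.

Definition mx_cvg (R : realType) m n (s : nat -> 'M[R[i]]_(m, n))
    (A : 'M[R[i]]_(m, n)) : Prop :=
  forall i j, (fun k => complex.Re (s k i j)) @ \oo --> complex.Re (A i j) /\
              (fun k => complex.Im (s k i j)) @ \oo --> complex.Im (A i j).

(* unordered sum of a family of matrices, entry by entry *)
Definition mx_sum (R : realType) (I : choiceType) m n
    (F : I -> 'M[R[i]]_(m, n)) : 'M[R[i]]_(m, n) :=
  \matrix_(i, j)
    (summability.sum (fun x => complex.Re (F x i j) : R^o) +i*
     summability.sum (fun x => complex.Im (F x i j) : R^o)).

Section Deficiency.
Variables (R : realType) (U : machine) (a : seq bool).

(* m(x / y) *)
Definition univ_prob (x y : seq bool) : \bar R :=
  \esum_(p in [set p | computes U a y p x]) ((2%:R ^- size p)%:E).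

(* The conditional string is empty: only the oracle is available to [q]. *)
Definition lower_computes n (q : seq bool) (S : 'M[R[i]]_(2 ^ n)) : Prop :=
  psdmx S /\
  exists r : nat -> 'M[gauss_rat]_(2 ^ n),
    [/\ outputs_sequence U a q (fun k => mx_code (r k)),
        forall k, semi_density (mx_val R (r k)),
        forall k, psdmx (mx_val R (r k.+1) - mx_val R (r k))
      & mx_cvg (fun k => mx_val R (r k)) S].

Definition lower_computable n (S : 'M[R[i]]_(2 ^ n)) : Prop :=
  exists q, lower_computes q S.

(* the underlined m(S / x) *)
Definition lower_prob n (S : 'M[R[i]]_(2 ^ n)) (x : seq bool) : \bar R :=
  \esum_(q in [set q | lower_computes q S]) univ_prob q x.

Definition tests n (rho : 'M[R[i]]_(2 ^ n)) : set 'M[R[i]]_(2 ^ n) :=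
  [set nu | lower_computable nu /\ \tr (nu *m rho) <= 1].

Definition universal_test n (rho : 'M[R[i]]_(2 ^ n)) : 'M[R[i]]_(2 ^ n) :=
  mx_sum (fun nu : 'M[R[i]]_(2 ^ n) =>
            if nu \in tests rho
            then (fine (lower_prob nu (nat_code n)))%:C *: nu else 0).

(* d(sigma | rho), with log in base 2 and log 0 = -oo *)
Definition deficiency n (sigma rho : 'M[R[i]]_(2 ^ n)) : \bar R :=
  (lne (complex.Re (\tr (universal_test rho *m sigma)))%:E *
   ((ln 2)^-1)%:E)%E.

End Deficiency.

(* Main.v *)
Require Import Defs.
From HB Require Import structures.
From mathcomp Require Import all_boot all_order all_algebra.
From mathcomp Require Import complex sesquilinear spectral.
From mathcomp Require Import all_classical all_reals all_analysis.
From mathcomp Require Import finmap zify ring lra.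
From mathcomp Require showcase.summability.

Set Implicit Arguments.
Unset Strict Implicit.
Unset Printing Implicit Defensive.

Import Order.TTheory GRing.Theory Num.Theory.
Import numFieldNormedType.Exports.

(** Conjugation by the unitary A maps the tests of rho onto those of A rho A^*
    and preserves the traces, so it suffices to compare weights.  A machine that
    holds A on its oracle tape simulates U and replaces every matrix r that U
    writes by A r A^*; hence some fixed string e is such that e ++ q lower
    computes A nu A^* whenever q lower computes nu.  Another fixed machine
    writes e in front of what U writes, so that e ++ q is at most a constant
    factor less probable than q.  Summing over q, then over the tests, bounds one
    deficiency by the other; the machine that multiplies by A^* and A instead
    gives the converse.  The sums converge by Kraft's inequality, because a
    halting program determines q, and q determines nu.

    The matrix multiplication is programmed for counters: a counter is the
    position of a head on a tape whose cell 0 is marked, lists of naturals are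
    stored in one counter by a pairing function, and U is run one bit at a time
    whenever the counter program asks for input. *)

(** The constant is chosen before [n], [A] and the oracle string, so no matrix can be built into the
    conjugating machine: it decodes [A] from the oracle tape and then rewinds that tape, since the
    simulated [U] must find it as at the start. Universality is assumed of machines as literally
    defined, hence the computability of r -> A r A^* must be shown down to a transition function;
    the layers of expressions, structured programs and counter programs exist for that. A lower
    computing program never halts, so correctness speaks of finite initial segments of an endless
    output. Both inequalities concern one and the same oracle string, which is why a flag [adj]
    selects A^* inside the machine instead of an encoding of A^* being supplied. On the analytic
    side, [universal_test] is an entrywise unordered sum: total weight at most 1 and test entries
    bounded by 1 make it converge absolutely, and nonnegative traces then allow a comparison term by
    term along the injection nu -> B nu B^*. *)

Local Notation shift := Defs.shift.
Local Notation mx_val := Defs.mx_val.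

#[local] Existing Instance summability.totally_filter.

(** * Counter programs *)

Section CounterCode.
Local Open Scope nat_scope.

Inductive instr :=
  | Inc of nat | Dec of nat | Jz of nat & nat | Jmp of nat
  | Rd of nat | Emit of nat.

Definition regs := nat -> nat.

Definition upd (R : regs) r v : regs := fun x => if x == r then v else R x.

Definition memory : Type := (regs * seq bool * seq bool)%type.

(** The memory consists of the registers, the input still to be read and the output so far. [Rd]
    adds the bit to its register instead of storing it, because a single head move can do that. *)
Inductive cstep (C : seq instr) : nat -> memory -> nat -> memory -> Prop :=
  | CInc pc r R i o : onth C pc = Some (Inc r) ->
      cstep C pc (R, i, o) pc.+1 (upd R r (R r).+1, i, o)
  | CDec pc r R i o : onth C pc = Some (Dec r) ->
      cstep C pc (R, i, o) pc.+1 (upd R r (R r).-1, i, o)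
  | CJz pc r l R i o : onth C pc = Some (Jz r l) ->
      cstep C pc (R, i, o) (if R r == 0 then l else pc.+1) (R, i, o)
  | CJmp pc l R i o : onth C pc = Some (Jmp l) ->
      cstep C pc (R, i, o) l (R, i, o)
  | CRd pc r R b i o : onth C pc = Some (Rd r) ->
      cstep C pc (R, b :: i, o) pc.+1 (upd R r (R r + b), i, o)
  | CEmit pc r R i o : onth C pc = Some (Emit r) ->
      cstep C pc (R, i, o) pc.+1 (R, i, rcons o (R r != 0)).

Inductive csteps (C : seq instr) : nat -> memory -> nat -> memory -> Prop :=
  | CRefl pc m : csteps C pc m pc m
  | CTrans pc m pc1 m1 pc2 m2 :
      cstep C pc m pc1 m1 -> csteps C pc1 m1 pc2 m2 -> csteps C pc m pc2 m2.

Lemma csteps1 C pc m pc' m' : cstep C pc m pc' m' -> csteps C pc m pc' m'.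
Proof. by move=> h; apply: CTrans h (CRefl _ _ _). Qed.

Lemma csteps_trans C pc m pc1 m1 pc2 m2 :
  csteps C pc m pc1 m1 -> csteps C pc1 m1 pc2 m2 -> csteps C pc m pc2 m2.
Proof. by elim=> // *; apply: CTrans; eauto. Qed.

(** * Structured programs and their compilation *)

Inductive stmt :=
  | SInc of nat | SDec of nat | SRd of nat | SEmit of nat
  | SSeq of stmt & stmt | SWhile of nat & stmt.

Inductive exec : stmt -> memory -> memory -> Prop :=
  | XInc r R i o : exec (SInc r) (R, i, o) (upd R r (R r).+1, i, o)
  | XDec r R i o : exec (SDec r) (R, i, o) (upd R r (R r).-1, i, o)
  | XRd r R b i o : exec (SRd r) (R, b :: i, o) (upd R r (R r + b), i, o)
  | XEmit r R i o : exec (SEmit r) (R, i, o) (R, i, rcons o (R r != 0))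
  | XSeq s1 s2 m m1 m2 : exec s1 m m1 -> exec s2 m1 m2 ->
      exec (SSeq s1 s2) m m2
  | XWhile0 r s R i o : R r = 0 -> exec (SWhile r s) (R, i, o) (R, i, o)
  | XWhileS r s R i o m1 m2 : R r != 0 -> exec s (R, i, o) m1 ->
      exec (SWhile r s) m1 m2 -> exec (SWhile r s) (R, i, o) m2.

(** Jump targets are absolute, hence the argument [b]: the address at which the code is placed. *)
Fixpoint compile (s : stmt) (b : nat) : seq instr :=
  match s with
  | SInc r => [:: Inc r]
  | SDec r => [:: Dec r]
  | SRd r => [:: Rd r]
  | SEmit r => [:: Emit r]
  | SSeq s1 s2 => let c1 := compile s1 b in c1 ++ compile s2 (b + size c1)
  | SWhile r s => let c := compile s b.+1 in
      Jz r (b + size c + 2) :: c ++ [:: Jmp b]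
  end.

Lemma onth_cat_size (T : Type) (p : seq T) x s :
  onth (p ++ x :: s) (size p) = Some x.
Proof. by elim: p. Qed.

(** One pass, from the loop test back to it. It is kept apart from [compile_correct] because the
    main loop of the final program never exits: [exec] has no derivation for it, and its run is
    assembled from such passes. *)
Lemma compile_loop r s R i o m1 C pre post : R r != 0 ->
  (forall C pre post, C = pre ++ compile s (size pre) ++ post ->
   csteps C (size pre) (R, i, o) (size pre + size (compile s (size pre))) m1) ->
  C = pre ++ compile (SWhile r s) (size pre) ++ post ->
  csteps C (size pre) (R, i, o) (size pre) m1.
Proof.
move=> Rr IH1 /=; set c := compile s _ => Ce.
have h : onth C (size pre) = Some (Jz r (size pre + size c + 2)).
  by rewrite Ce onth_cat_size.
have := CJz R i o h; rewrite (negbTE Rr) => hs.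
apply: CTrans hs _.
apply: csteps_trans.
  have := IH1 C (rcons pre (Jz r (size pre + size c + 2)))
    ([:: Jmp (size pre)] ++ post).
  by rewrite size_rcons; apply; rewrite -/c Ce cat_rcons /= -!catA.
case: m1 {IH1} => [[R1 i1] o1]; rewrite -/c; apply/csteps1/CJmp.
have -> : (size pre).+1 + size c =
    size (rcons pre (Jz r (size pre + size c + 2)) ++ c).
  by rewrite size_cat size_rcons.
rewrite Ce -cat_rcons -!catA.
rewrite [X in onth X _]catA.
by apply: onth_cat_size.
Qed.

Lemma compile_correct s m m' : exec s m m' -> forall C pre post,
  C = pre ++ compile s (size pre) ++ post ->
  csteps C (size pre) m (size pre + size (compile s (size pre))) m'.
Proof.
elim=> {s m m'}; rewrite ?addn1.
- move=> r R i o C pre post -> /=; rewrite addn1.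
  by apply/csteps1/CInc; rewrite onth_cat_size.
- move=> r R i o C pre post -> /=; rewrite addn1.
  by apply/csteps1/CDec; rewrite onth_cat_size.
- move=> r R b i o C pre post -> /=; rewrite addn1.
  by apply/csteps1/CRd; rewrite onth_cat_size.
- move=> r R i o C pre post -> /=; rewrite addn1.
  by apply/csteps1/CEmit; rewrite onth_cat_size.
- move=> s1 s2 m m1 m2 _ IH1 _ IH2 C pre post ->/=.
  set c1 := compile s1 _; set c2 := compile s2 _.
  apply: csteps_trans; first by apply: (IH1 _ pre (c2 ++ post)); rewrite -catA.
  have {IH2} := IH2 (pre ++ (c1 ++ c2) ++ post) (pre ++ c1) post.
  by rewrite !size_cat addnA -/c1 -/c2; apply; rewrite -!catA.
- move=> r s R i o Rr C pre post -> /=.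
  set c := compile s _; rewrite size_cat /=.
  have -> : (size pre + (size c + 1).+1 = size pre + size c + 2) by lia.
  set D := (D in csteps D).
  have h : onth D (size pre) = Some (Jz r (size pre + size c + 2)).
    by rewrite /D onth_cat_size.
  by have := csteps1 (CJz R i o h); rewrite Rr.
move=> r s R i o m1 m2 Rr _ IH1 _ IH2 C pre post Ce.
apply: csteps_trans (IH2 _ _ _ Ce).
exact: compile_loop Ce.
Qed.

End CounterCode.

(** * Running a counter program on the output of a machine *)

Section Pipe.
Local Open Scope nat_scope.
Variables (U : machine) (C : seq instr).

Definition instr_reg (x : instr) :=
  match x with
  | Inc r | Dec r | Jz r _ | Rd r | Emit r => r
  | Jmp _ => 0
  end.

Let K := \max_(x <- C) instr_reg x.
Let L := size C.
Let k := ntapes U.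
(** All work tapes of a machine share one alphabet, so a cell carries both a symbol of [U] and a
    mark bit; the former matters on the tapes of [U], the latter on the counter tapes. *)
Let symb : finType := (symbol U * bool)%type.

(* [None]: markers not yet written; [Some None]: rewinding the oracle head;
   [Some (Some false)]: the bits read come from the oracle tape;
   [Some (Some true)]: they come from the output of [U]. *)
Let phase : finType := option (option bool).
Let pstate : finType := (phase * 'I_L.+1 * state U)%type.

(** Addresses beyond the end are identified with [L], where no instruction stands either; this keeps
    the set of states finite. *)
Definition to_pc (pc : nat) : 'I_L.+1 := inord (minn pc L).

Definition joint (s : {ffun 'I_(k + K.+1) -> symb})
    (w : 'I_k -> symbol U * direction) (mv : 'I_K.+1 -> direction) :
    {ffun 'I_(k + K.+1) -> symb * direction} :=
  [ffun i => match fintype.split i with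
             | inl j => (((w j).1, (s i).2), (w j).2)
             | inr r => (s i, mv r)
             end].

Definition keep (s : {ffun 'I_(k + K.+1) -> symb}) (j : 'I_k) :=
  ((s (lshift _ j)).1, Stay).

Definition move (r : nat) (d : direction) (j : 'I_K.+1) :=
  if j == r :> nat then d else Stay.

(* The counter on a tape is the head position; cell 0 carries the mark. *)
Definition is_zero (s : {ffun 'I_(k + K.+1) -> symb}) (r : nat) : bool :=
  (s (rshift _ (inord r))).2.

(** A [Rd] served by [U] holds the program counter still while [U] makes its steps, and releases it
    in the very step in which [U] writes a bit. That bit goes straight into the counter, so nothing
    is buffered. *)
Definition pipe_trans (q : pstate) (y a : option bool)
    (s : {ffun 'I_(k + K.+1) -> symb}) : action pstate symb (k + K.+1) :=
  let: (ph, pc, u) := q in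
  let act ph' pc' mv d o :=
    Act (ph', to_pc pc', u) Stay d (joint s (keep s) mv) o in
  let still := fun=> Stay in
  match ph with
  | None => Act (Some (Some false), ord0, u) Stay Stay
      [ffun i => (((s i).1, true), Stay)] None
  | Some _ =>
    match onth C pc with
    | None => Halt
    | Some (Inc r) => act ph pc.+1 (move r Right) Stay None
    | Some (Dec r) =>
        act ph pc.+1 (move r (if is_zero s r then Stay else Left)) Stay None
    | Some (Jz r l) => act ph (if is_zero s r then l else pc.+1) still Stay None
    | Some (Jmp l) => act ph l still Stay None
    | Some (Emit r) => act ph pc.+1 still Stay (Some (~~ is_zero s r))
    | Some (Rd r) =>
      match ph with
      | Some (Some true) =>
        match trans u y a [ffun j => (s (lshift _ j)).1] with
        | Halt => Halt
        | Read f => Read _ _ (fun b => (ph, pc, f b))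
        | Act u' d1 d2 w o =>
            Act (ph, if o is Some _ then to_pc pc.+1 else pc, u') d1 d2
              (joint s w (move r (if o is Some true then Right else Stay))) None
        end
      | Some (Some false) =>
          if a is Some b
          then act ph pc.+1 (move r (if b then Right else Stay)) Right None
          else act (Some None) pc still Left None
      | _ =>
          if a is Some _ then act ph pc still Left None
          else act (Some (Some true)) pc still Right None
      end
    end
  end.

Definition pipe : machine :=
  @Machine pstate symb (blank U, false) (k + K.+1) (None, ord0, start U)
    pipe_trans.

Definition reach (c c' : config pipe) := exists t, iter t (@step pipe) c = c'.

Lemma reach_refl c : reach c c. Proof. by exists 0. Qed.

Lemma reach_trans c c1 c2 : reach c c1 -> reach c1 c2 -> reach c c2.
Proof. by move=> [t <-] [t' <-]; exists (t' + t); rewrite iterD. Qed.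

Lemma reach1 c : reach c (step c). Proof. by exists 1. Qed.

(** The oracle tape is left out: its relation to that of [U] changes from phase to phase and is
    tracked separately. *)
Record core (c : config pipe) (ph : phase) (pc : nat) (R : regs)
    (o : seq bool) (cu : config U) : Prop := Core {
  core_state : cstate c = (ph, to_pc pc, cstate cu);
  core_unread : unread c = unread cu;
  core_cond : cond_tape c = cond_tape cu;
  core_pos : forall j, (work c (lshift _ j)).1 = (work cu j).1;
  core_cell : forall j z, ((work c (lshift _ j)).2 z).1 = (work cu j).2 z;
  core_cpos : forall r : 'I_K.+1, (work c (rshift _ r)).1 = Posz (R r);
  core_mark : forall (r : 'I_K.+1) z,
    ((work c (rshift _ r)).2 z).2 = (z == 0%R);
  core_out : out c = o }.

Lemma shift_stay S (t : tape S) : shift Stay t = t.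
Proof. by case: t => z f; rewrite /shift /= addr0. Qed.

Lemma onth_to_pc pc : onth C (to_pc pc) = onth C pc.
Proof.
rewrite inordK ?ltnS ?geq_minr// /minn; case: ltnP => // h.
by rewrite !onth_default.
Qed.

Lemma to_pcK pc : to_pc (to_pc pc) = to_pc pc.
Proof.
apply: val_inj => /=.
by rewrite !inordK ?ltnS ?geq_minr// (minn_idPl (geq_minr _ _)).
Qed.

Lemma to_pcS pc : to_pc (to_pc pc).+1 = to_pc pc.+1.
Proof. by apply: val_inj => /=; rewrite !inordK ?ltnS ?geq_minr//; lia. Qed.

Lemma onth_reg pc x : onth C pc = Some x -> (instr_reg x < K.+1).
Proof.
move=> h; rewrite ltnS /K; elim: C pc h => [[]//|y s IH [|pc] /= h].
  by case: h => ->; rewrite big_cons leq_maxl.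
by rewrite big_cons; apply: leq_trans (IH _ h) (leq_maxr _ _).
Qed.

Lemma core_is_zero c ph pc R o cu r : core c ph pc R o cu -> r < K.+1 ->
  is_zero [ffun i => scan (work c i)] r = (R r == 0).
Proof.
move=> h rK; rewrite /is_zero ffunE /scan (core_mark h) (core_cpos h).
by rewrite inordK.
Qed.

Definition displace (d : direction) (n : nat) :=
  match d with Left => n.-1 | Stay => n | Right => n.+1 end.

(** The condition on [Left] keeps every counter head at a nonnegative position, where position and
    value coincide. *)
Lemma joint_core c ph pc R o cu ph' pc' cu' w mv q d1 d2 o' :
  core c ph pc R o cu ->
  (forall r : 'I_K.+1, mv r = Left -> R r != 0) ->
  q = (ph', to_pc pc', cstate cu') ->
  unread cu' = unread cu ->
  cond_tape cu' = shift d1 (cond_tape cu) ->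
  (forall j, work cu' j = shift (w j).2 (write (w j).1 (work cu j))) ->
  core (@Config pipe q (unread c) (shift d1 (cond_tape c)) d2
    (fun i => shift (joint [ffun i => scan (work c i)] w mv i).2
       (write (joint [ffun i => scan (work c i)] w mv i).1 (work c i)))
    (out c ++ seq_of_opt o'))
  ph' pc' (fun r => if insub r is Some j then displace (mv j) (R r) else R r)
  (o ++ seq_of_opt o') cu'.
Proof.
move=> h hmv qE uE cE wE; split => //=.
- by rewrite uE (core_unread h).
- by rewrite cE (core_cond h).
- move=> j; rewrite wE ffunE.
  by case: fintype.splitP => [j' /= /val_inj <-|r /= ]; [rewrite (core_pos h)|move: (ltn_ord j) => /=; lia].
- move=> j z; rewrite wE ffunE.
  case: fintype.splitP => [j' /= /val_inj <-|r /= ]; last by move: (ltn_ord j) => /=; lia.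
  by rewrite (core_pos h); case: ifP => // _; rewrite (core_cell h).
- move=> r; rewrite valK /= ffunE.
  case: fintype.splitP => [j' /= |r' /= /addnI/val_inj <-].
    by move: (ltn_ord j') => /=; lia.
  rewrite (core_cpos h) /=; move: (hmv r); case: (mv r) => //= [/(_ erefl)|_|_]; lia.
- move=> r z; rewrite ffunE.
  case: fintype.splitP => [j' /= |r' _].
    by move: (ltn_ord j') => /=; lia.
  by rewrite /= ffunE (core_cpos h) /scan; case: eqP => [->|_]; rewrite ?(core_cpos h) (core_mark h).
- by rewrite (core_out h).
Qed.

Lemma core_ext c ph pc R o cu R' : core c ph pc R o cu ->
  (forall r, r < K.+1 -> R' r = R r) -> core c ph pc R' o cu.
Proof.
by case=> h1 h2 h3 h4 h5 h6 h7 h8 e; split => // r; rewrite h6 e.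
Qed.

Lemma write_scan S (t : tape S) : write (scan t) t = t.
Proof.
case: t => z f; rewrite /write /scan /=; congr pair.
by apply/funext => x; case: eqP => [->|].
Qed.

Lemma act_core c ph pc R o cu ph' pc' mv d o' :
  core c ph pc R o cu ->
  next_action c = Act (ph', to_pc pc', cstate cu) Stay d
    (joint [ffun i => scan (work c i)] (keep [ffun i => scan (work c i)]) mv)
    o' ->
  (forall r : 'I_K.+1, mv r = Left -> R r != 0) ->
  core (step c) ph' pc'
    (fun r => if insub r is Some j then displace (mv j) (R r) else R r)
    (o ++ seq_of_opt o') cu
  /\ oracle_tape (step c) = shift d (oracle_tape c).
Proof.
move=> h hn hmv; rewrite /step hn; split => //.
apply: (joint_core (ph' := ph') (pc' := pc') _ _ h hmv) => //.
  by rewrite shift_stay.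
move=> j; rewrite /keep /= ffunE /scan (core_cell h) (core_pos h).
by rewrite shift_stay -/(scan _) write_scan.
Qed.

(** * Lockstep of the machine with the counter program and with [U] *)

Section Simulation.
Variables a y p : seq bool.

(** [consumed] is what the counter program has read so far: a part of the oracle string at first,
    later the whole of it followed by everything [U] has written up to some time [t]. *)
Definition inv (consumed : seq bool) c pc R o :=
  (core c (Some (Some false)) pc R o (init U a y p) /\
   oracle_tape c = (Posz (size consumed), (string_tape a).2) /\
   prefix consumed a) \/
  exists t, core c (Some (Some true)) pc R o (run U a y p t) /\
    oracle_tape c = oracle_tape (run U a y p t) /\
    consumed = a ++ out (run U a y p t).

Lemma inv_silent consumed c pc R o pc' mv o' (R' : regs) :
  inv consumed c pc R o ->
  (forall ph u b1 b2,
     pipe_trans (Some (Some ph), to_pc pc, u) b1 b2 [ffun i => scan (work c i)]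
     = Act (Some (Some ph), to_pc pc', u) Stay Stay
    (joint [ffun i => scan (work c i)] (keep [ffun i => scan (work c i)]) mv)
    o') ->
  (forall r : 'I_K.+1, mv r = Left -> R r != 0) ->
  (forall r : 'I_K.+1, R' r = displace (mv r) (R r)) ->
  inv consumed (step c) pc' R' (o ++ seq_of_opt o').
Proof.
move=> [[h [ho hp]]|[t [h [ho hp]]]] ht hmv hR; [left|right; exists t].
- have hn : next_action c = Act (Some (Some false), to_pc pc',
      cstate (init U a y p)) Stay Stay
    (joint [ffun i => scan (work c i)] (keep [ffun i => scan (work c i)]) mv)
    o' by rewrite /next_action (core_state h); apply: ht.
  have [h1 h2] := act_core h hn hmv; split; last by rewrite h2 shift_stay.
  by apply: core_ext h1 _ => r rK; rewrite (insubT (fun x => x < K.+1) rK) -hR.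
have hn : next_action c = Act (Some (Some true), to_pc pc',
      cstate (run U a y p t)) Stay Stay
    (joint [ffun i => scan (work c i)] (keep [ffun i => scan (work c i)]) mv)
    o' by rewrite /next_action (core_state h); apply: ht.
have [h1 h2] := act_core h hn hmv; split; last by rewrite h2 shift_stay.
by apply: core_ext h1 _ => r rK; rewrite (insubT (fun x => x < K.+1) rK) -hR.
Qed.

Lemma inv_is_zero consumed c pc R o r : inv consumed c pc R o -> r < K.+1 ->
  is_zero [ffun i => scan (work c i)] r = (R r == 0).
Proof. by move=> [[h _]|[t [h _]]]; apply: core_is_zero h. Qed.

Lemma out_step (c : config U) : exists s, out (step c) = out c ++ seq_of_opt s.
Proof.
rewrite /step; case: (next_action c) => [|f|q d1 d2 w o] /=.
- by exists None; rewrite cats0.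
- by exists None; case: (unread c) => [|? ?] /=; rewrite cats0.
- by exists o.
Qed.

Lemma move_upd r d (R : regs) (j : 'I_K.+1) :
  upd R r (displace d (R r)) j = displace (move r d j) (R j).
Proof. by rewrite /upd /move; case: eqP => [->|]. Qed.

Lemma addb_displace (b : bool) n :
  n + b = displace (if b then Right else Stay) n.
Proof. by case: b; rewrite ?addn1 ?addn0. Qed.

Lemma not_left_move r b (R : regs) (j : 'I_K.+1) :
  move r (if b then Right else Stay) j = Left -> R j != 0.
Proof. by rewrite /move; case: eqP => // _; case: b. Qed.

(** Induction on the number [t] of steps within which [U] is known to write the awaited bit; during
    its silent steps the counter program waits at the same [Rd]. *)
Lemma sim_reading t' t c pc R o r b i :
  onth C pc = Some (Rd r) ->
  core c (Some (Some true)) pc R o (run U a y p t') ->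
  oracle_tape c = oracle_tape (run U a y p t') ->
  prefix (out (run U a y p t') ++ b :: i) (out (run U a y p (t' + t))) ->
  exists c', reach c c' /\
    inv (a ++ rcons (out (run U a y p t')) b) c' pc.+1 (upd R r (R r + b)) o.
Proof.
move=> hpc; elim: t t' c => [|t IH] t' c h ho hp.
  by have := size_prefix hp; rewrite addn0 size_cat /=; lia.
have [s hs] := out_step (run U a y p t').
have hn : next_action c = pipe_trans (Some (Some true), to_pc pc,
    cstate (run U a y p t')) (scan (cond_tape (run U a y p t')))
    (scan (oracle_tape (run U a y p t'))) [ffun i => scan (work c i)].
  by rewrite /next_action (core_state h) (core_cond h) ho.
rewrite [RHS]/= onth_to_pc hpc to_pcS in hn.
have hw : [ffun j => ([ffun i0 => scan (work c i0)] (lshift K.+1 j)).1] =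
    [ffun i0 => scan (work (run U a y p t') i0)].
  by apply/ffunP => j; rewrite !ffunE /scan (core_cell h) (core_pos h).
rewrite hw in hn.
(* A halted or starved [U] would write nothing more, although [b] is still to come. *)
have stuck : step (run U a y p t') = run U a y p t' -> False.
  move=> e; move: hp; rewrite addnC /run iterD -/(run U a y p t').
  rewrite iter_fix // => /size_prefix; rewrite size_cat /=; lia.
case E : (next_action (run U a y p t')) => [|f|q d1 d2 w o'].
- by case: stuck; rewrite /step E.
- case Eu : (unread (run U a y p t')) => [|b' w].
    by case: stuck; rewrite /step E Eu.
  rewrite /next_action in E; rewrite E in hn.
  have hs' : run U a y p t'.+1 = Config (f b') w
     (cond_tape (run U a y p t')) (oracle_tape (run U a y p t'))
     (work (run U a y p t')) (out (run U a y p t')).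
    by rewrite /run iterS -/(run U a y p t') /step /next_action E Eu.
  have := IH t'.+1 (step c); rewrite hs' /=.
  have -> : step c = @Config pipe (Some (Some true), to_pc pc, f b') w
    (cond_tape c) (oracle_tape c) (work c) (out c).
    by rewrite /step hn (core_unread h) Eu.
  move=> /(_ _ ho) [].
  + by case: h => *; split.
  + by move: hp; rewrite addnS.
  move=> c' [hr hi]; exists c'; split => //; apply: reach_trans hr.
  exists 1; rewrite /= /step hn.
  by rewrite (core_unread h) Eu.
have hs' : run U a y p t'.+1 = Config q (unread (run U a y p t'))
     (shift d1 (cond_tape (run U a y p t')))
     (shift d2 (oracle_tape (run U a y p t')))
     (fun j => shift (w j).2 (write (w j).1 (work (run U a y p t') j)))
     (out (run U a y p t') ++ seq_of_opt o').
  by rewrite /run iterS -/(run U a y p t') /step E.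
rewrite /next_action in E; rewrite E in hn.
have mvP := @not_left_move r (if o' is Some true then true else false) R.
have hc : core (step c) (Some (Some true)) (if o' is Some _ then pc.+1 else pc)
    (if o' is Some b then upd R r (R r + b) else R) o (run U a y p t'.+1).
  rewrite /step hn hs'.
  apply: (@core_ext _ _ _ (fun x => if insub x is Some j
      then displace (move r (if (if o' is Some true then true else false)
                    then Right else Stay) j) (R x) else R x)).
    rewrite -(cats0 o).
    by case: o' mvP {hs hs' hn E} => [[]|] mvP;
      apply: (joint_core (ph' := Some (Some true)) _ None h mvP).
  move=> x xK; rewrite (insubT (fun x => x < K.+1) xK) /=.
  case: o' {mvP hs hs' hn E} => [b'|].
    have := move_upd r (if b' then Right else Stay) R (Ordinal xK).
    by rewrite -addb_displace => ->; case: b'.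
  by rewrite /move; case: ifP.
have hoc : oracle_tape (step c) = oracle_tape (run U a y p t'.+1).
  by rewrite /step hn hs' /= ho.
case: o' hs' hc {mvP hn E} => [b'|] hs' hc.
(* Output only grows, so the bit written now stays the next one after the current output, and [hp]
   says that this is [b]. *)
- have eb : b' = b.
    have [i' hi'] : exists i', out (run U a y p (t' + t.+1)) =
        out (run U a y p t'.+1) ++ i'.
      rewrite addnS -addSn addnC; elim: (t) => [|u [i' hi']].
        by exists [::]; rewrite cats0.
      rewrite addSn /run iterS -/(run U a y p (u + t'.+1)).
      have [s' ->] := out_step (run U a y p (u + t'.+1)).
      by exists (i' ++ seq_of_opt s'); rewrite hi' catA.
    move: hp; rewrite hi' hs' /= -catA prefix_catr ?eqxx //=.
    by move=> /andP[/eqP].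
  exists (step c); split; first exact: reach1.
  right; exists t'.+1; rewrite -eb; split => //; split => //.
  by rewrite hs' /= cats1.
have [|c' [hr hi]] := IH t'.+1 (step c) hc hoc.
  by rewrite addSnnS hs' /= cats0.
exists c'; split; first exact: reach_trans (reach1 _) hr.
by move: hi; rewrite hs' /= cats0.
Qed.

(** The head is on cell n - 1. The blank at cell -1 reveals the left end, and one move right then
    restores the initial position. *)
Lemma rewind c pc R o r n : onth C pc = Some (Rd r) -> n <= size a ->
  core c (Some None) pc R o (init U a y p) ->
  oracle_tape c = ((Posz n - 1)%R, (string_tape a).2) ->
  exists c', [/\ reach c c', core c' (Some (Some true)) pc R o (init U a y p)
    & oracle_tape c' = string_tape a].
Proof.
move=> hpc; elim: n c => [|n IH] c hn h ho.
  have hna : next_action c = Act (Some (Some true), to_pc pc,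
      cstate (init U a y p)) Stay Right
    (joint [ffun i => scan (work c i)] (keep [ffun i => scan (work c i)])
       (fun=> Stay)) None.
    rewrite /next_action (core_state h) /= onth_to_pc hpc ho /scan /=.
    by rewrite to_pcK.
  have [//|h1 h2] := act_core h hna.
  exists (step c); split; first exact: reach1.
    move: h1; rewrite cats0 => h1; apply: core_ext h1 _ => x xK.
    by rewrite (insubT (fun x => x < K.+1) xK).
  by rewrite h2 ho /string_tape.
have hna : next_action c = Act (Some None, to_pc pc,
      cstate (init U a y p)) Stay Left
    (joint [ffun i => scan (work c i)] (keep [ffun i => scan (work c i)])
       (fun=> Stay)) None.
  have e1 : (Posz n.+1 - 1)%R = Posz n by lia.
  have [b hb] : exists b, onth a n = Some b.
    by move: (onthTE a n); rewrite hn; case: onth => // b _; exists b.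
  rewrite /next_action (core_state h) ho e1 /= onth_to_pc hpc /scan /= hb.
  by rewrite to_pcK.
have [//|h1 h2] := act_core h hna.
have [|||c' [hr hc ho']] := IH (step c).
- exact: ltnW.
- move: h1; rewrite cats0 => h1; apply: core_ext h1 _ => x xK.
  by rewrite (insubT (fun x => x < K.+1) xK).
- by rewrite h2 ho /shift /=; congr pair; lia.
by exists c'; split => //; apply: reach_trans (reach1 _) hr.
Qed.

Lemma feeding consumed c pc R o r b :
  onth C pc = Some (Rd r) ->
  core c (Some (Some false)) pc R o (init U a y p) ->
  oracle_tape c = (Posz (size consumed), (string_tape a).2) ->
  prefix (rcons consumed b) a ->
  inv (rcons consumed b) (step c) pc.+1 (upd R r (R r + b)) o.
Proof.
move=> hpc h ho hp; have [a' ha] := prefixP hp.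
have hb : onth a (size consumed) = Some b by rewrite ha cat_rcons onth_cat_size.
have hna : next_action c = Act (Some (Some false), to_pc pc.+1,
      cstate (init U a y p)) Stay Right
    (joint [ffun i => scan (work c i)] (keep [ffun i => scan (work c i)])
       (move r (if b then Right else Stay))) None.
  rewrite /next_action (core_state h) /= onth_to_pc hpc ho /scan /= hb.
  by rewrite to_pcS.
have [h1 h2] := act_core h hna (@not_left_move _ _ _).
left; split; last first.
  split; last by [].
  by rewrite h2 ho /shift /= size_rcons; congr pair; lia.
move: h1; rewrite cats0 => h1; apply: core_ext h1 _ => x xK.
rewrite (insubT (fun x => x < K.+1) xK) addb_displace.
exact: (move_upd _ _ _ (Ordinal xK)).
Qed.

Lemma end_feeding c pc R o r :
  onth C pc = Some (Rd r) ->
  core c (Some (Some false)) pc R o (init U a y p) ->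
  oracle_tape c = (Posz (size a), (string_tape a).2) ->
  exists c', [/\ reach c c', core c' (Some (Some true)) pc R o (init U a y p)
    & oracle_tape c' = string_tape a].
Proof.
move=> hpc h ho.
have hb : onth a (size a) = None by rewrite onth_default.
have hna : next_action c = Act (Some None, to_pc pc,
      cstate (init U a y p)) Stay Left
    (joint [ffun i => scan (work c i)] (keep [ffun i => scan (work c i)])
       (fun=> Stay)) None.
  rewrite /next_action (core_state h) /= onth_to_pc hpc ho /scan /= hb.
  by rewrite to_pcK.
have [//|h1 h2] := act_core h hna.
have [|||c' [hr hc ho']] := @rewind (step c) pc R o r (size a) hpc.
- exact: leqnn.
- move: h1; rewrite cats0 => h1; apply: core_ext h1 _ => x xK.
  by rewrite (insubT (fun x => x < K.+1) xK).
- by rewrite h2 ho /shift /=; congr pair; lia.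
by exists c'; split => //; apply: reach_trans (reach1 _) hr.
Qed.

(** The bit comes from the oracle tape or from [U]; between the two lies the case where the oracle
    string has just been exhausted and the tape must be rewound first. *)
Lemma reading t consumed c pc R o r b i :
  onth C pc = Some (Rd r) -> inv consumed c pc R o ->
  prefix (consumed ++ b :: i) (a ++ out (run U a y p t)) ->
  exists c', reach c c' /\
    inv (rcons consumed b) c' pc.+1 (upd R r (R r + b)) o.
Proof.
move=> hpc [[h [ho hc]]|[t' [h [ho hc]]]] hp; last first.
  have hp' : prefix (out (run U a y p t') ++ b :: i) (out (run U a y p t)).
    by move: hp; rewrite hc -catA prefix_catr // eqxx.
  have lt : t' <= t.
    case: leqP => // /ltnW tt; move: (size_prefix hp'); rewrite size_cat /=.
    suff : size (out (run U a y p t)) <= size (out (run U a y p t')) by lia.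
    rewrite -(subnK tt); elim: (t' - t) => // n IH; apply: leq_trans IH _.
    rewrite addSn [in leqRHS]/run iterS -/(run U a y p _).
    by have [s ->] := out_step (run U a y p (n + t)); rewrite size_cat leq_addr.
  rewrite -(subnKC lt) in hp'.
  have [c' [hr hi]] := sim_reading hpc h ho hp'.
  by exists c'; split => //; rewrite hc rcons_cat.
have [a' ea] := prefixP hc.
case: a' ea => [|b' a'] ea.
  rewrite cats0 in ea; rewrite -ea in ho.
  have [c' [hr hc' ho']] := end_feeding hpc h ho.
  have hp' : prefix (out (run U a y p 0) ++ b :: i) (out (run U a y p (0 + t))).
    by move: hp; rewrite ea prefix_catr // eqxx.
  have [c'' [hr' hi]] := sim_reading hpc (t' := 0) hc' ho' hp'.
  exists c''; split; first exact: reach_trans hr hr'.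
  by move: hi => /=; rewrite cats1 ea.
exists (step c); split; first exact: reach1.
apply: feeding => //; move: hp; rewrite ea -catA prefix_catr ?eqxx //=.
by move=> /andP[/eqP -> _]; rewrite -cat_rcons prefix_prefix.
Qed.

Lemma pipe_steps t pc R i o pc' R' i' o' :
  csteps C pc (R, i, o) pc' (R', i', o') -> forall consumed c,
  inv consumed c pc R o ->
  prefix (consumed ++ i) (a ++ out (run U a y p t)) ->
  exists c' consumed', reach c c' /\ inv consumed' c' pc' R' o'.
Proof.
move E : (R, i, o) => m; move E' : (R', i', o') => m' hs.
elim: hs R i o E E' => [{}pc {}m|{}pc {}m pc1 m1 pc2 m2 h1 h2 IH] R i o E E' consumed c hi hp.
  move: E'; rewrite -E => -[-> _ ->].
  by exists c, consumed; split => //; exact: reach_refl.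
suff [R1 [i1 [ o1 [c1 [consumed1 [e1 hr hi1 hp1]]]]]] : exists R1 i1 o1 c1 consumed1,
    [/\ (R1, i1, o1) = m1, reach c c1, inv consumed1 c1 pc1 R1 o1 &
        prefix (consumed1 ++ i1) (a ++ out (run U a y p t))].
  have [c' [cs [hr' hi']]] := IH _ _ _ e1 E' _ _ hi1 hp1.
  by exists c', cs; split => //; apply: reach_trans hr'.
case: h1 hi E => {h2 IH E'} {}pc r.
- move=> R1 i1 o1 hpc hi [? ? ?]; subst R1 i1 o1.
  exists (upd R r (R r).+1), i, o, (step c), consumed; split => //.
    exact: reach1.
  rewrite -[X in inv _ _ _ _ X]cats0.
  apply: (inv_silent (mv := move r Right) (o' := None) hi).
  + by move=> ph u b1 b2; rewrite /= onth_to_pc hpc to_pcS.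
  + by move=> j; rewrite /move; case: eqP.
  + exact: (move_upd r Right).
- move=> R1 i1 o1 hpc hi [? ? ?]; subst R1 i1 o1.
  exists (upd R r (R r).-1), i, o, (step c), consumed; split => //.
    exact: reach1.
  rewrite -[X in inv _ _ _ _ X]cats0.
  apply: (inv_silent (mv := move r (if R r == 0 then Stay else Left))
           (o' := None) hi).
  + move=> ph u b1 b2; rewrite /= onth_to_pc hpc to_pcS (inv_is_zero hi) //.
    exact: onth_reg hpc.
  + by move=> j; rewrite /move; case: eqP => // ->; case: eqP.
  + move=> j; rewrite -(move_upd r (if R r == 0 then Stay else Left)).
    by congr (upd _ _ _ _); case: eqP => // ->.
- move=> l R1 i1 o1 hpc hi [? ? ?]; subst R1 i1 o1.
  exists R, i, o, (step c), consumed; split => //.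
    exact: reach1.
  rewrite -[X in inv _ _ _ _ X]cats0.
  apply: (inv_silent (mv := fun=> Stay) (o' := None) hi) => //.
  move=> ph u b1 b2; rewrite /= onth_to_pc hpc (inv_is_zero hi) //.
    by case: ifP; rewrite ?to_pcS.
  exact: onth_reg hpc.
- move=> R1 i1 o1 hpc hi [? ? ?]; subst R1 i1 o1.
  exists R, i, o, (step c), consumed; split => //.
    exact: reach1.
  rewrite -[X in inv _ _ _ _ X]cats0.
  apply: (inv_silent (mv := fun=> Stay) (o' := None) hi) => //.
  by move=> ph u b1 b2; rewrite /= onth_to_pc hpc.
- move=> R1 b i1 o1 hpc hi [? ? ?]; subst R1 i o1.
  have [c1 [hr hi1]] := reading hpc hi hp.
  exists (upd R r (R r + b)), i1, o, c1, (rcons consumed b); split => //.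
  by rewrite cat_rcons.
- move=> R1 i1 o1 hpc hi [? ? ?]; subst R1 i1 o1.
  exists R, i, (rcons o (R r != 0)), (step c), consumed; split => //.
    exact: reach1.
  rewrite -cats1.
  apply: (inv_silent (mv := fun=> Stay) (o' := Some (R r != 0)) hi) => //.
  move=> ph u b1 b2; rewrite /= onth_to_pc hpc to_pcS (inv_is_zero hi) //.
  exact: onth_reg hpc.
Qed.

Lemma pipe_start : inv [::] (step (init pipe a y p)) 0 (fun=> 0) [::].
Proof.
left; split; last by split; [exact: shift_stay | exact: prefix0s].
split => //.
- by congr (_, _, _); apply: val_inj; rewrite /= inordK ?min0n.
- by move=> j; rewrite /= ffunE /= addr0.
- by move=> j z; rewrite /= !ffunE /=; case: ifP.
- by move=> j; rewrite /= ffunE.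
- by move=> j z; rewrite /= !ffunE /=; case: ifP.
Qed.

(** A finite run of the counter program reads a finite input, so [U] is followed only until it has
    written [w]; neither machine has to halt. *)
Theorem pipe_emits w i pc' R' i' o' :
  emits U a y p w -> prefix i (a ++ w) ->
  csteps C 0 (fun=> 0, i, [::]) pc' (R', i', o') ->
  emits pipe a y p o'.
Proof.
move=> [t ht] hi hs.
have hp : prefix ([::] ++ i) (a ++ out (run U a y p t)).
  apply: prefix_trans hi _.
  by rewrite prefix_catr ?eqxx.
have [c' [cs [[t' hr] hc]]] := pipe_steps hs pipe_start hp.
exists (t' + 1); rewrite /run iterD /= hr.
by case: hc => [[h _]|[? [h _]]]; rewrite (core_out h) prefix_refl.
Qed.

End Simulation.

End Pipe.

(** * Compiling arithmetic expressions *)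

Section Expressions.
Local Open Scope nat_scope.

(** Variables are de Bruijn indices. In [Iter n z b] the body sees the accumulator as variable 0 and
    the number of the round as variable 1: this is primitive recursion, which suffices for matrix
    arithmetic. *)
Inductive expr :=
  | Var of nat | Zero | Succ of expr | Pred of expr
  | Iter of expr & expr & expr.

Definition scons (x : nat) (env : nat -> nat) (n : nat) : nat :=
  if n is n'.+1 then env n' else x.

Fixpoint eval (e : expr) (env : nat -> nat) : nat :=
  match e with
  | Var i => env i
  | Zero => 0
  | Succ e => (eval e env).+1
  | Pred e => (eval e env).-1
  | Iter n z b => iteri (eval n env)
      (fun i acc => eval b (scons acc (scons i env))) (eval z env)
  end.

Lemma eq_eval e env env' : env =1 env' -> eval e env = eval e env'.
Proof. by move=> /funext ->. Qed.

Fixpoint rename (s : nat -> nat) (e : expr) : expr :=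
  match e with
  | Var i => Var (s i)
  | Zero => Zero
  | Succ e => Succ (rename s e)
  | Pred e => Pred (rename s e)
  | Iter n z b => Iter (rename s n) (rename s z)
      (rename (scons 0 (scons 1 (fun i => (s i).+2))) b)
  end.

Lemma eval_rename e s env : eval (rename s e) env = eval e (env \o s).
Proof.
elim: e s env => //= [e IH|e IH|n IHn z IHz b IHb] s env; rewrite ?IH //.
rewrite IHn IHz; apply: eq_iteri => i acc; rewrite IHb; apply: eq_eval.
by case=> [|[]].
Qed.

(** Invariant and termination are given together by exhibiting the memory [M j] before each of the
    [k] rounds; the simple loops are all run this way. *)
Lemma exec_while r s (M : nat -> memory) k :
  (forall j, j < k -> exec s (M j) (M j.+1) /\ (M j).1.1 r != 0) ->
  (M k).1.1 r = 0 -> exec (SWhile r s) (M 0) (M k).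
Proof.
elim: k M => [|k IH] M h h0.
  by case: (M 0) h0 => [[R i] o] /= h0; apply: XWhile0.
have [h1 h2] := h 0 isT; have := IH (M \o succn) (fun j hj => h j.+1 hj) h0.
move: h1 h2 => /=; case: (M 0) => [[R i] o] /= h1 h2 h3.
exact: XWhileS h2 h1 h3.
Qed.

Lemma exec_eq s m R1 R2 i o : exec s m (R1, i, o) -> R1 =1 R2 ->
  exec s m (R2, i, o).
Proof. by move=> h /funext <-. Qed.

Definition clear r := SWhile r (SDec r).

Lemma upd_same R r : upd R r (R r) = R.
Proof. by apply/funext => x; rewrite /upd; case: eqP => [->|]. Qed.

Lemma upd_at R r v : upd R r v r = v.
Proof. by rewrite /upd eqxx. Qed.

Lemma upd_upd R r u v : upd (upd R r u) r v = upd R r v.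
Proof. by apply/funext => x; rewrite /upd; case: eqP. Qed.

Lemma exec_clear r R i o : exec (clear r) (R, i, o) (upd R r 0, i, o).
Proof.
have := @exec_while r (SDec r) (fun j => (upd R r (R r - j), i, o)) (R r).
rewrite subn0 upd_same subnn; apply; last by rewrite /= /upd eqxx.
move=> j jR; split; last by rewrite /= /upd eqxx; lia.
have := XDec r (upd R r (R r - j)) i o.
by rewrite upd_upd upd_at -subnS.
Qed.

Definition transfer r t := SSeq (clear t) (SWhile r (SSeq (SDec r) (SInc t))).

Lemma exec_transfer r t R i o : r != t ->
  exec (transfer r t) (R, i, o) (upd (upd R r 0) t (R r), i, o).
Proof.
move=> rt; apply: XSeq (exec_clear _ _ _ _) _.
have := @exec_while r (SSeq (SDec r) (SInc t))
  (fun j => (upd (upd R r (R r - j)) t j, i, o)) (R r).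
rewrite subn0 upd_same subnn; apply; last by rewrite /= /upd (negbTE rt) eqxx.
move=> j jR; split; last by rewrite /= /upd (negbTE rt) eqxx; lia.
apply: XSeq; first exact: XDec.
apply: exec_eq (XInc _ _ _ _) _ => x; rewrite /upd !eqxx (negbTE rt).
rewrite [t == r]eq_sym (negbTE rt).
by case: (x =P t) => //; case: (x =P r) => //; rewrite subnS.
Qed.

Definition copy r t u :=
  SSeq (SWhile r (SSeq (SDec r) (SSeq (SInc t) (SInc u)))) (transfer u r).

Lemma exec_copy r t u R i o : r != t -> r != u -> t != u ->
  R t = 0 -> R u = 0 -> exec (copy r t u) (R, i, o) (upd R t (R r), i, o).
Proof.
move=> rt ru tu t0 u0.
apply: (@XSeq _ _ _ (upd (upd (upd R r 0) t (R r)) u (R r), i, o)).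
  have := @exec_while r (SSeq (SDec r) (SSeq (SInc t) (SInc u)))
    (fun j => (upd (upd (upd R r (R r - j)) t j) u j, i, o)) (R r).
  have -> : upd (upd (upd R r (R r - 0)) t 0) u 0 = R.
    apply/funext => x; rewrite /upd subn0.
    case: (x =P u) => [->//|_]; case: (x =P t) => [->//|_].
    by case: (x =P r) => [->|].
  rewrite subnn.
  apply; last by rewrite /= /upd (negbTE rt) (negbTE ru) eqxx.
  move=> j jR; split; last first.
    by rewrite /= /upd (negbTE rt) (negbTE ru) eqxx; lia.
  apply: XSeq; first exact: XDec.
  set R1 := upd _ r _; apply: XSeq; first exact: XInc.
  apply: exec_eq (XInc _ _ _ _) _ => x; rewrite /R1 /upd !eqxx.
  rewrite (negbTE rt) (negbTE ru) [u == t]eq_sym (negbTE tu).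
  rewrite [u == r]eq_sym (negbTE ru) [t == r]eq_sym (negbTE rt).
  by case: (x == u) => //; case: (x == t); case: (x == r) => //; rewrite ?subnS.
have ur : u != r by rewrite eq_sym.
apply: exec_eq (exec_transfer _ _ _ ur) _ => x; rewrite /upd eqxx.
case: (x =P r) => [->|_]; first by rewrite (negbTE rt).
by case: (x =P u) => // ->; rewrite eq_sym (negbTE tu).
Qed.

(** [m] locates the variables in registers below [f], and the value is delivered in [f]. For [Iter],
    [f] counts down, [f.+1] accumulates, [f.+2] holds the number of the round, and the body is
    computed at [f.+3]. *)
Fixpoint compile_expr (m : nat -> nat) (f : nat) (e : expr) : stmt :=
  match e with
  | Var i => copy (m i) f f.+1
  | Zero => clear f
  | Succ e => SSeq (compile_expr m f e) (SInc f)
  | Pred e => SSeq (compile_expr m f e) (SDec f)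
  | Iter n z b =>
    SSeq (compile_expr m f n)
   (SSeq (compile_expr m f.+1 z)
   (SSeq (SWhile f
            (SSeq (compile_expr (scons f.+1 (scons f.+2 m)) f.+3 b)
            (SSeq (transfer f.+3 f.+1)
            (SSeq (SInc f.+2) (SDec f)))))
   (SSeq (clear f.+2) (transfer f.+1 f))))
  end.

(** Registers from [f] on are zero before, and all of them except [f] are zero again afterwards;
    this is what lets successive subexpressions share the scratch space. *)
Lemma exec_expr e m f R i o :
  (forall r, f <= r -> R r = 0) -> (forall j, m j < f) ->
  exec (compile_expr m f e) (R, i, o) (upd R f (eval e (R \o m)), i, o).
Proof.
elim: e m f R => /= [j||e IH|e IH|n IHn z IHz b IHb] m f R.
- move=> h hm; have hj := hm j; apply: exec_copy; rewrite ?h //; lia.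
- move=> h hm; exact: exec_clear.
- move=> h hm; apply: XSeq; first exact: IH.
  set R1 := upd _ f _; have := XInc f R1 i o.
  by rewrite /R1 upd_upd upd_at.
- move=> h hm; apply: XSeq; first exact: IH.
  set R1 := upd _ f _; have := XDec f R1 i o.
  by rewrite /R1 upd_upd upd_at.
move=> h hm; set env := R \o m.
set N := eval n env; set Z := eval z env.
pose acc j := iteri j (fun i acc => eval b (scons acc (scons i env))) Z.
pose S j := upd (upd (upd R f (N - j)) f.+1 (acc j)) f.+2 j.
apply: XSeq; first exact: IHn.
apply: XSeq; first apply: IHz.
- by move=> r hr; rewrite /upd gtn_eqF //; apply: h; lia.
- by move=> j; apply: leq_trans (hm j) _.
have -> : upd (upd R f (eval n (R \o m))) f.+1
    (eval z (upd R f (eval n (R \o m)) \o m)) = S 0.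
  apply/funext => x; rewrite /S /upd subn0.
  case: (x =P f.+1) => [->|_].
    rewrite ifF; last by lia.
    by apply: eq_eval => j /=; rewrite ltn_eqF.
  by case: (x =P f.+2) => // ->; rewrite ifF ?h //; lia.
apply: (@XSeq _ _ _ (S N, i, o)).
  apply: (@exec_while _ _ (fun j => (S j, i, o))); last first.
    by rewrite /S /= /upd subnn eqxx !ifF //; lia.
  move=> j jN; split; last by rewrite /S /= /upd eqxx !ifF //; lia.
  apply: XSeq; first apply: IHb.
  - by move=> r hr; rewrite /S /upd !ifF ?h //; lia.
  - by case=> [|[|j']] /=; rewrite ?ltnS //; have := hm j'; lia.
  have -> : eval b (S j \o scons f.+1 (scons f.+2 m)) = acc j.+1.
    rewrite /acc iteriS -/(acc j); apply: eq_eval => -[|[|j']] /=.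
    - by rewrite /S /upd eqxx ifF //; lia.
    - by rewrite /S /upd eqxx.
    - by have hj' := hm j'; rewrite /S /upd !ifF //; lia.
  apply: XSeq; first by apply: exec_transfer; lia.
  apply: XSeq; first exact: XInc.
  apply: exec_eq (XDec _ _ _ _) _ => x; rewrite /S /upd !eqxx.
  case: (x =P f) => [->|xf]; first by rewrite !ifF //; lia.
  case: (x =P f.+2) => [_|xf2]; first by rewrite !ifF //; lia.
  case: (x =P f.+1) => [//|xf1].
  by case: (x =P f.+3) => // ->; rewrite h //; lia.
apply: XSeq; first exact: exec_clear.
have ff : f.+1 != f by lia.
apply: exec_eq (exec_transfer _ _ _ ff) _ => x; rewrite /S /upd subnn eqxx.
case: (x =P f) => [_|xf]; first by rewrite !ifF //; lia.
case: (x =P f.+1) => [->|_]; first by rewrite h.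
by case: (x =P f.+2) => [->|_] //; rewrite h //; lia.
Qed.

End Expressions.

(** * Computable functions *)

Section Computable.
Local Open Scope nat_scope.

(** A sigma type rather than an existence statement, since [assign] compiles the expression it
    contains. *)
Definition computable (f : (nat -> nat) -> nat) :=
  {e : expr | forall env, eval e env = f env}.

Lemma computable_var i : computable (fun env => env i).
Proof. by exists (Var i). Defined.

Lemma computable_succ f : computable f -> computable (fun env => (f env).+1).
Proof. by move=> [e he]; exists (Succ e) => env /=; rewrite he. Qed.

Lemma computable_pred f : computable f -> computable (fun env => (f env).-1).
Proof. by move=> [e he]; exists (Pred e) => env /=; rewrite he. Qed.

Lemma computable_const c : computable (fun=> c).
Proof.
by elim: c => [|c IH]; [exists Zero | exact: (computable_succ IH)].
Qed.

Lemma computable_rename s f :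
  computable f -> computable (fun env => f (env \o s)).
Proof.
by move=> [e he]; exists (rename s e) => env; rewrite eval_rename he.
Qed.

Lemma computable_iter n z (b : nat -> nat -> (nat -> nat) -> nat) :
  computable n -> computable z ->
  computable (fun env => b (env 0) (env 1) (fun i => env i.+2)) ->
  computable (fun env => iteri (n env) (fun i acc => b acc i env) (z env)).
Proof.
move=> [en hn] [ez hz] [eb hb]; exists (Iter en ez eb) => env /=.
by rewrite hn hz; apply: eq_iteri => i acc; rewrite hb.
Qed.

Lemma computable_weaken f :
  computable f -> computable (fun env => f (fun i => env i.+2)).
Proof. exact: (computable_rename (fun i => i.+2)). Qed.

Lemma computable_add f g :
  computable f -> computable g -> computable (fun env => f env + g env).
Proof.
move=> hf hg; have := computable_iter hg hf
  (b := fun acc _ _ => acc.+1) (computable_succ (computable_var 0)).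
move=> [e he]; exists e => env; rewrite he.
by elim: (g env) => [|k IH] /=; rewrite ?addn0 // IH addnS.
Qed.

Lemma computable_sub f g :
  computable f -> computable g -> computable (fun env => f env - g env).
Proof.
move=> hf hg; have := computable_iter hg hf
  (b := fun acc _ _ => acc.-1) (computable_pred (computable_var 0)).
move=> [e he]; exists e => env; rewrite he.
by elim: (g env) => [|k IH] /=; rewrite ?subn0 // IH subnS.
Qed.

Lemma computable_sum n (F : nat -> (nat -> nat) -> nat) :
  computable n -> computable (fun env => F (env 0) (fun i => env i.+1)) ->
  computable (fun env => \sum_(k < n env) F k env).
Proof.
move=> hn hF; have := computable_iter hn (computable_const 0)
  (b := fun acc i env => acc + F i env)
  (computable_add (computable_var 0) (computable_rename succn hF)).
move=> [e he]; exists e => env; rewrite he.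
by elim: (n env) => [|k IH] /=; rewrite ?big_ord0 // big_ord_recr /= IH.
Qed.

Lemma computable_mul f g :
  computable f -> computable g -> computable (fun env => f env * g env).
Proof.
move=> hf hg; have := computable_iter hg (computable_const 0)
  (b := fun acc _ env => acc + f env)
  (computable_add (computable_var 0) (computable_weaken hf)).
move=> [e he]; exists e => env; rewrite he.
by elim: (g env) => [|k IH] /=; rewrite ?muln0 // IH mulnS addnC.
Qed.

Lemma computable_exp2 f : computable f -> computable (fun env => 2 ^ f env).
Proof.
move=> hf; have := computable_iter hf (computable_const 1)
  (b := fun acc _ _ => acc + acc)
  (computable_add (computable_var 0) (computable_var 0)).
move=> [e he]; exists e => env; rewrite he.
by elim: (f env) => [|k IH] //=; rewrite IH expnS mul2n addnn.
Qed.

Lemma computable_leq f g :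
  computable f -> computable g -> computable (fun env => (f env <= g env) : nat).
Proof.
move=> hf hg.
have [e he] := computable_sub (computable_const 1) (computable_sub hf hg).
by exists e => env; rewrite he; case: leqP; lia.
Qed.

Definition quotient x y := \sum_(k < x) (k.+1 * y <= x).

(** A test that holds exactly below [k] is passed [k] times. Bounded search thereby becomes a sum,
    which serves both for division and for the integer square root. *)
Lemma sum_below n k (P : pred nat) : k <= n -> (forall i, P i = (i < k)) ->
  \sum_(i < n) (P i : nat) = k.
Proof.
move=> kn hP; rewrite (eq_bigr (fun i : 'I_n => (i < k : nat))); last first.
  by move=> i _; rewrite hP.
rewrite -(big_mkord xpredT (fun i => (i < k) : nat)) (big_cat_nat (leq0n k) kn) //=.
rewrite [X in X + _]big_nat_cond (eq_bigr (fun=> 1)); last first.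
  by move=> i /andP[/andP[_ ->]].
rewrite -big_nat_cond sum_nat_const_nat muln1 subn0.
rewrite big_nat_cond big1 ?addn0 // => i /andP[/andP[ki _] _].
by rewrite ltnNge ki.
Qed.

Lemma quotientE x y : 0 < y -> quotient x y = x %/ y.
Proof.
move=> y0; apply: (@sum_below _ _ (fun k => k.+1 * y <= x)).
  exact: leq_div.
by move=> i; rewrite leq_divRL.
Qed.

Lemma computable_quotient f g : computable f -> computable g ->
  computable (fun env => quotient (f env) (g env)).
Proof.
move=> hf hg.
apply: (@computable_sum f (fun k env => (k.+1 * g env <= f env) : nat)) => //.
apply: computable_leq; last exact: (computable_rename succn hf).
apply: computable_mul; last exact: (computable_rename succn hg).
exact: computable_succ (computable_var 0).
Qed.

(* The sum a + x is recovered as the integer square root of the code. *)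
Definition pair_code a x := (a + x) * (a + x) + a.
Definition root z := \sum_(k < z) (k.+1 * k.+1 <= z).
Definition hd z := z - root z * root z.
Definition tl z := root z - hd z.

Lemma root_pair a x : root (pair_code a x) = a + x.
Proof.
apply: (@sum_below _ _ (fun k => k.+1 * k.+1 <= _)); rewrite /pair_code.
  by nia.
by move=> i; case: ltnP; nia.
Qed.

Lemma hd_pair a x : hd (pair_code a x) = a.
Proof. by rewrite /hd root_pair /pair_code addKn. Qed.

Lemma tl_pair a x : tl (pair_code a x) = x.
Proof. by rewrite /tl root_pair hd_pair addKn. Qed.

Lemma computable_root f : computable f -> computable (fun env => root (f env)).
Proof.
move=> hf.
apply: (@computable_sum f (fun k env => (k.+1 * k.+1 <= f env) : nat)) => //.
apply: computable_leq; last exact: (computable_rename succn hf).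
by apply: computable_mul; apply: computable_succ (computable_var 0).
Qed.

Lemma computable_hd f : computable f -> computable (fun env => hd (f env)).
Proof.
move=> hf; apply: computable_sub => //.
by apply: computable_mul; exact: computable_root.
Qed.

Lemma computable_tl f : computable f -> computable (fun env => tl (f env)).
Proof.
by move=> hf; apply: computable_sub; [exact: computable_root|exact: computable_hd].
Qed.

Lemma computable_pair f g : computable f -> computable g ->
  computable (fun env => pair_code (f env) (g env)).
Proof.
by move=> hf hg; do 2?[apply: computable_add || apply: computable_mul] => //;
  exact: computable_add.
Qed.

(** Not injective: [[::]] and [[:: 0]] both have code 0. Lengths are therefore supplied separately,
    from the number of qubits. *)
Fixpoint list_code (l : seq nat) : nat :=
  if l is x :: l' then pair_code x (list_code l') else 0.

Definition get z i := hd (iter i tl z).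

Lemma get_list_code l i : i < size l -> get (list_code l) i = nth 0 l i.
Proof.
rewrite /get; elim: l i => [|x l IH] [|i] //= hi; first by rewrite hd_pair.
by rewrite -iterS iterSr tl_pair IH.
Qed.

Lemma computable_get f g : computable f -> computable g ->
  computable (fun env => get (f env) (g env)).
Proof.
move=> hf hg; apply: computable_hd.
have [e he] := computable_iter hg hf (b := fun acc _ _ => tl acc)
  (computable_tl (computable_var 0)).
exists e => env; rewrite he.
by elim: (g env) => [|k IH] //=; rewrite IH.
Qed.

End Computable.

(** * Entries of the conjugated matrix *)

Section GaussianIntegers.
Local Open Scope nat_scope.

(* The integer p - q is represented by any pair (p, q) of naturals. *)
Definition dint : Type := (nat * nat)%type.
Definition dint_add (x y : dint) : dint := (x.1 + y.1, x.2 + y.2).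
Definition dint_opp (x : dint) : dint := (x.2, x.1).
Definition dint_mul (x y : dint) : dint :=
  (x.1 * y.1 + x.2 * y.2, x.1 * y.2 + x.2 * y.1).

Definition gint : Type := (dint * dint)%type.
Definition gint_mul (x y : gint) : gint :=
  (dint_add (dint_mul x.1 y.1) (dint_opp (dint_mul x.2 y.2)),
   dint_add (dint_mul x.1 y.2) (dint_mul x.2 y.1)).
Definition gint_conj (x : gint) : gint := (x.1, dint_opp x.2).
Definition gint_sum n (F : nat -> gint) : gint :=
  ((\sum_(k < n) (F k).1.1, \sum_(k < n) (F k).1.2),
   (\sum_(k < n) (F k).2.1, \sum_(k < n) (F k).2.2)).

Definition computable_gint (F : (nat -> nat) -> gint) : Type :=
  (computable (fun env => (F env).1.1) * computable (fun env => (F env).1.2) *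
   (computable (fun env => (F env).2.1) * computable (fun env => (F env).2.2))).

Lemma computable_gint_mul F G : computable_gint F -> computable_gint G ->
  computable_gint (fun env => gint_mul (F env) (G env)).
Proof.
move=> [[f1 f2] [f3 f4]] [[g1 g2] [g3 g4]].
by do 2!split; rewrite /=;
  do 2!apply: computable_add; apply: computable_mul.
Qed.

Lemma computable_gint_conj F : computable_gint F ->
  computable_gint (fun env => gint_conj (F env)).
Proof. by move=> [[f1 f2] [f3 f4]]. Qed.

Lemma computable_gint_sum n (F : nat -> (nat -> nat) -> gint) :
  computable n -> computable_gint (fun env => F (env 0) (fun i => env i.+1)) ->
  computable_gint (fun env => gint_sum (n env) (fun k => F k env)).
Proof.
move=> hn [[f1 f2] [f3 f4]]; do 2!split; rewrite /=.
- exact: (@computable_sum n (fun k env => (F k env).1.1)).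
- exact: (@computable_sum n (fun k env => (F k env).1.2)).
- exact: (@computable_sum n (fun k env => (F k env).2.1)).
- exact: (@computable_sum n (fun k env => (F k env).2.2)).
Qed.

Definition gint_val (R : realType) (x : gint) : R[i] :=
  ((x.1.1%:R - x.1.2%:R) +i* (x.2.1%:R - x.2.2%:R))%R.

Lemma gint_val_mul R x y :
  gint_val R (gint_mul x y) = (gint_val R x * gint_val R y)%R.
Proof.
apply/eqP; rewrite eq_complex /= !natrD !natrM; apply/andP.
by split; apply/eqP; ring.
Qed.

Lemma gint_val_conj R x : gint_val R (gint_conj x) = ((gint_val R x)^*)%C.
Proof. by apply/eqP; rewrite eq_complex /= eqxx opprB eqxx. Qed.

Lemma gint_val_sum R n F :
  gint_val R (gint_sum n F) = (\sum_(k < n) gint_val R (F k))%R.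
Proof.
elim: n => [|n IH].
  by rewrite /gint_sum !big_ord0 /gint_val /= !subrr.
rewrite big_ord_recr /= -IH /gint_sum !big_ord_recr /=.
apply/eqP; rewrite eq_complex /= !natrD; apply/andP.
by split; apply/eqP; ring.
Qed.

Definition dint_neg (x : dint) : bool := x.1 < x.2.
(** [Negz k] is -(k + 1), so a negative difference contributes its magnitude less one; by truncation
    the other term is then 0. *)
Definition dint_abs (x : dint) : nat := (x.1 - x.2) + (x.2 - x.1).-1.
Definition dint_int (x : dint) : int :=
  if dint_neg x then Negz (dint_abs x) else Posz (dint_abs x).

Lemma dint_int_code x :
  int_code (dint_int x) = dint_neg x :: nat_code (dint_abs x).
Proof. by rewrite /dint_int; case: dint_neg. Qed.

Lemma dint_intE (R : realType) x : ((dint_int x)%:~R = x.1%:R - x.2%:R :> R)%R.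
Proof.
have -> : dint_int x = (Posz x.1 - Posz x.2)%R.
  by rewrite /dint_int /dint_neg /dint_abs; case: ltnP => h; lia.
by rewrite intrB.
Qed.

Definition gint_rat (x : gint) (D : nat) : gauss_rat :=
  (dint_int x.1, dint_int x.2, D.-1).

Lemma gint_ratE (R : realType) x D : 0 < D ->
  gauss_rat_val R (gint_rat x D) = (gint_val R x / D%:R)%R.
Proof.
move=> D0; rewrite /gauss_rat_val /gint_rat prednK // !dint_intE.
have -> : (D%:R : R[i]) = (D%:R)%:C%C by rewrite raddfMn.
rewrite -fmorphV; apply/eqP; rewrite eq_complex /=.
by rewrite !mulr0 subr0 add0r addrC ?addr0 ?add0r !eqxx.
Qed.

End GaussianIntegers.

(** * Matrix entries on a stack, and the entries of the conjugate *)

Section Entries.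
Local Open Scope nat_scope.

Definition int_neg (z : int) : bool := if z is Negz _ then true else false.
Definition int_cnt (z : int) : nat := match z with Posz k | Negz k => k end.

Lemma int_codeE z : int_code z = int_neg z :: nat_code (int_cnt z).
Proof. by case: z. Qed.

(* Components are pushed one after the other, so the last one is on top. *)
Definition rat_stack (x : gauss_rat) : seq nat :=
  let: (a, b, d) := x in
  [:: d; int_cnt b; int_neg b : nat; int_cnt a; int_neg a : nat].

Definition rats_stack (es : seq gauss_rat) : seq nat :=
  flatten (map rat_stack (rev es)).

Definition den (x : gauss_rat) : nat := x.2.+1.

(** The product serves as common denominator because it can be accumulated while the entries are
    being read. *)
Definition dens (es : seq gauss_rat) : nat := \prod_(x <- es) den x.

Lemma dens_gt0 es : 0 < dens es.
Proof. by apply: prodn_gt0. Qed.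

(** Each entry occupies five places, and entry [e] lies under the [size es - e.+1] entries pushed
    after it. *)
Lemma nth_rats_stack es e c x0 : e < size es -> c < 5 ->
  nth 0 (rats_stack es) (5 * (size es - e.+1) + c) =
  nth 0 (rat_stack (nth x0 es e)) c.
Proof.
move=> he hc.
have -> : nth x0 es e = nth x0 (rev es) (size es - e.+1).
  by rewrite nth_rev; [congr nth; lia | lia].
rewrite /rats_stack; move: (rev es) (size_rev es) => s hs.
have : size es - e.+1 < size s by rewrite hs; lia.
move: (size es - e.+1) => q.
elim: s q {hs} => [|x s IH] [|q] //= hq; rewrite nth_cat.
- by rewrite muln0 add0n; case: x => [[a b] d] /=; rewrite hc.
rewrite ifF; last by case: x => [[a b] d] /=; lia.
rewrite -IH //; congr nth; case: x => [[a b] d] /=; lia.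
Qed.

Lemma size_rats_stack es : size (rats_stack es) = 5 * size es.
Proof.
rewrite /rats_stack size_flatten /shape -map_comp.
rewrite (eq_map (g := fun=> 5)); last by case=> [[a b] d].
by rewrite -(size_rev es); elim: (rev es) => //= _ s ->; rewrite mulnS.
Qed.

(* The result is scaled by the common denominator [D]. *)
Definition entry (X N D e : nat) : gint :=
  let comp c := get X (5 * (N - e.+1) + c) in
  let q := quotient D (comp 0).+1 in
  let part s v := ((1 - s) * v * q, s * v.+1 * q) in
  (part (comp 4) (comp 3), part (comp 2) (comp 1)).

Lemma entryE (R : realType) es e x0 : e < size es ->
  gint_val R (entry (list_code (rats_stack es)) (size es) (dens es) e) =
  ((dens es)%:R * gauss_rat_val R (nth x0 es e))%R.
Proof.
move=> he; rewrite /entry.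
have hg c : c < 5 ->
    get (list_code (rats_stack es)) (5 * (size es - e.+1) + c) =
    nth 0 (rat_stack (nth x0 es e)) c.
  move=> hc; rewrite get_list_code; last by rewrite size_rats_stack; lia.
  exact: nth_rats_stack.
rewrite !hg //.
have hx : nth x0 es e \in es by rewrite mem_nth.
case E : (nth x0 es e) hx => [[a b] d] hx /=.
rewrite quotientE //.
have [q hq] : exists q, dens es = q * d.+1.
  exists (\prod_(x <- rem (a, b, d) es) den x).
  by rewrite /dens (perm_big _ (perm_to_rem hx)) big_cons mulnC.
rewrite hq mulnK //.
have -> : ((q * d.+1)%:R : R[i])%R = ((q * d.+1)%:R)%:C%C by rewrite raddfMn.
have d0 : (d.+1%:R : R)%R != 0%R by rewrite pnatr_eq0.
(* The successor again reflects that [Negz k] is -(k + 1); the sign bit decides which of the two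
   terms survives. *)
have part z : (((1 - int_neg z) * int_cnt z * q)%:R -
    (int_neg z * (int_cnt z).+1 * q)%:R = z%:~R * q%:R :> R)%R.
  case: z => k /=; rewrite ?mul1n ?mul0n ?subnn ?mul0n ?subn0 ?mul1n ?subr0 ?sub0r natrM //.
  by rewrite NegzE mulrNz mulNr.
apply/eqP; rewrite eq_complex /= !part !mul0r subr0 addr0 natrM.
by apply/andP; split; apply/eqP; field.
Qed.

Lemma computable_entry X N D e :
  computable X -> computable N -> computable D -> computable e ->
  computable_gint (fun env => entry (X env) (N env) (D env) (e env)).
Proof.
move=> hX hN hD he.
have hc c : computable (fun env =>
    get (X env) (5 * (N env - (e env).+1) + c)).
  apply: computable_get => //; apply: computable_add; last first.
    exact: computable_const.
  apply: computable_mul; first exact: computable_const.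
  by apply: computable_sub => //; exact: computable_succ.
have hq : computable (fun env =>
    quotient (D env) (get (X env) (5 * (N env - (e env).+1) + 0)).+1).
  by apply: computable_quotient => //; exact: computable_succ.
do 2!split; rewrite /=; apply: computable_mul => //; apply: computable_mul => //.
- by apply: computable_sub => //; exact: computable_const.
- exact: computable_succ.
- by apply: computable_sub => //; exact: computable_const.
- exact: computable_succ.
Qed.

(* the entry (i, k) of A, or of A^* when [adj] *)
Definition factor (adj : bool) X D n i k : gint :=
  if adj then gint_conj (entry X (2 ^ n * 2 ^ n) D (k * 2 ^ n + i))
  else entry X (2 ^ n * 2 ^ n) D (i * 2 ^ n + k).

(** With B equal to A or A^*, this is the numerator, over the denominator [DA * DA * DR], of the
    entry of B r B^* whose row-major index is [e]. *)
Definition conj_entry (adj : bool) LA DA LR DR n e : gint :=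
  let m := 2 ^ n in
  let i := quotient e m in
  let j := e - i * m in
  gint_sum m (fun k => gint_sum m (fun l =>
    gint_mul (gint_mul (factor adj LA DA n i k)
                       (entry LR (m * m) DR (k * m + l)))
             (gint_conj (factor adj LA DA n j l)))).

Lemma computable_factor adj X D n i k :
  computable X -> computable D -> computable n -> computable i ->
  computable k ->
  computable_gint
    (fun env => factor adj (X env) (D env) (n env) (i env) (k env)).
Proof.
move=> hX hD hn hi hk; have hm := computable_exp2 hn.
rewrite /factor; case: adj; [apply: computable_gint_conj|];
  apply: computable_entry => //; try exact: computable_mul;
  by apply: computable_add => //; exact: computable_mul.
Qed.

Lemma computable_conj_entry adj : computable_gint (fun env =>
  conj_entry adj (env 0) (env 1) (env 2) (env 3) (env 4) (env 8)).
Proof.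
have hv := computable_var; have hm i := computable_exp2 (hv i).
have hq i j := computable_quotient (hv i) (hm j).
have hr i j := computable_sub (hv i) (computable_mul (hq i j) (hm j)).
apply: (@computable_gint_sum (fun env => 2 ^ env 4) (fun k env =>
  gint_sum (2 ^ env 4) (fun l =>
    gint_mul (gint_mul (factor adj (env 0) (env 1) (env 4)
                               (quotient (env 8) (2 ^ env 4)) k)
                (entry (env 2) (2 ^ env 4 * 2 ^ env 4) (env 3)
                   (k * 2 ^ env 4 + l)))
             (gint_conj (factor adj (env 0) (env 1) (env 4)
         (env 8 - quotient (env 8) (2 ^ env 4) * 2 ^ env 4) l))))) => //.
(* Each sum binds its index as variable 0, so the program variables move up by one, and by two
   inside both sums. *)
apply: (@computable_gint_sum (fun env => 2 ^ env 5) (fun l env =>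
    gint_mul (gint_mul (factor adj (env 1) (env 2) (env 5)
                               (quotient (env 9) (2 ^ env 5)) (env 0))
                (entry (env 3) (2 ^ env 5 * 2 ^ env 5) (env 4)
                   (env 0 * 2 ^ env 5 + l)))
             (gint_conj (factor adj (env 1) (env 2) (env 5)
         (env 9 - quotient (env 9) (2 ^ env 5) * 2 ^ env 5) l)))) => //.
apply: computable_gint_mul.
  apply: computable_gint_mul; first exact: (computable_factor adj (hv 2) (hv 3) (hv 6) (hq 10 6) (hv 1)).
  apply: (computable_entry (hv 4) (computable_mul (hm 6) (hm 6)) (hv 5)).
  exact: (computable_add (computable_mul (hv 1) (hm 6)) (hv 0)).
apply: computable_gint_conj.
exact: (computable_factor adj (hv 2) (hv 3) (hv 6) (hr 10 6) (hv 0)).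
Qed.

End Entries.

(** * The program *)

Section Program.
Local Open Scope nat_scope.

(* Registers 0 to 10 are program variables and those from 12 on are scratch;
   register 11 stays 0 and stands for every variable out of range. *)
Definition tidy (R : regs) := forall r, 11 <= r -> R r = 0.

Definition assign x f (hf : computable f) :=
  SSeq (compile_expr (fun i => minn i 11) 12 (sval hf)) (transfer 12 x).

Lemma tidy_upd R x v : x < 11 -> tidy R -> tidy (upd R x v).
Proof. by move=> hx h r hr; rewrite /upd gtn_eqF ?h //; lia. Qed.

Lemma exec_assign x f (hf : computable f) R i o : x < 11 -> tidy R ->
  exec (assign x hf) (R, i, o) (upd R x (f R), i, o).
Proof.
move=> hx hR; apply: XSeq.
  apply: exec_expr => [r hr|j]; first by apply: hR; lia.
  by rewrite ltnS geq_minr.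
have h12 : 12 != x by lia.
apply: exec_eq (exec_transfer _ _ _ h12) _ => r.
rewrite (svalP hf) upd_at; have -> : R \o minn^~ 11 = R.
  by apply/funext => j /=; rewrite /minn; case: ltnP => // hj; rewrite !hR.
rewrite /upd; case: (r =P x) => // _; case: (r =P 12) => // ->.
by rewrite hR.
Qed.

Definition read_nat x :=
  SSeq (clear x) (SSeq (SRd 6)
    (SWhile 6 (SSeq (SDec 6) (SSeq (SInc x) (SRd 6))))).

Lemma nth_nat_code k j : j <= k -> nth false (nat_code k) j = (j < k).
Proof.
move=> h; rewrite /nat_code nth_rcons size_nseq nth_nseq.
by case: ltnP => //; case: eqP.
Qed.

Lemma exec_read_nat x R k i o : x != 6 -> R 6 = 0 ->
  exec (read_nat x) (R, nat_code k ++ i, o) (upd R x k, i, o).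
Proof.
move=> x6 R6; apply: XSeq (exec_clear _ _ _ _) _.
have sz : size (nat_code k) = k.+1 by rewrite size_rcons size_nseq.
(* In [M j], j + 1 bits have been read and j of them counted; register 6 holds the last one, which
   is 0 exactly at the end of the code. *)
pose M j : memory := (upd (upd R x j) 6 (j < k : nat),
                      drop j.+1 (nat_code k) ++ i, o).
have next j : j <= k -> drop j (nat_code k) = (j < k) :: drop j.+1 (nat_code k).
  by move=> hj; rewrite (drop_nth false) ?sz // nth_nat_code.
have x6' : 6 == x = false by rewrite eq_sym (negbTE x6).
have Mk : M k = (upd R x k, i, o).
  rewrite /M ltnn drop_oversize ?sz //; congr (_, _, _); apply/funext => r.
  by rewrite /upd; case: (r =P 6) => // ->; rewrite x6'.
apply: (@XSeq _ _ _ (M 0)).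
  rewrite -[nat_code k in X in exec _ X](drop0) next //=.
  have := XRd 6 (upd R x 0) (0 < k) (drop 1 (nat_code k) ++ i) o.
  by have -> : upd R x 0 6 = 0; [rewrite /upd x6' R6 | rewrite add0n].
rewrite -Mk; apply: exec_while; last by rewrite Mk /= /upd x6'.
move=> j jk; split; last by rewrite /M /= upd_at jk.
rewrite /M next ?cat_cons //.
apply: XSeq; first exact: XDec.
apply: XSeq; first exact: XInc.
apply: exec_eq (XRd _ _ _ _ _) _ => r; rewrite /upd !eqxx (negbTE x6) x6' jk /=.
case: (r =P 6) => // _; by case: (r =P x).
Qed.

Definition emit_nat x := SSeq (SWhile x (SSeq (SEmit x) (SDec x))) (SEmit x).

Lemma exec_emit_nat x R i o :
  exec (emit_nat x) (R, i, o) (upd R x 0, i, o ++ nat_code (R x)).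
Proof.
pose M j : memory := (upd R x (R x - j), i, o ++ nseq j true).
apply: (@XSeq _ _ _ (M (R x))); last first.
  have := XEmit x (upd R x 0) i (o ++ nseq (R x) true).
  by rewrite upd_at /M subnn rcons_cat.
have -> : (R, i, o) = M 0 by rewrite /M subn0 upd_same cats0.
apply: exec_while; last by rewrite /M /= upd_at subnn.
move=> j jR; split; last by rewrite /M /= upd_at; lia.
apply: XSeq; first exact: XEmit.
have -> : rcons (o ++ nseq j true) (upd R x (R x - j) x != 0) =
    o ++ nseq j.+1 true.
  rewrite upd_at rcons_cat; have -> : R x - j != 0 by lia.
  by congr cat; rewrite -cats1 -(nseqD j 1) addn1.
by apply: exec_eq (XDec _ _ _ _) _ => r; rewrite upd_upd upd_at subnS.
Qed.

Section Reading.
Variable second : bool.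
(** Registers 0 and 1 hold the stack and common denominator of A, 2 and 3 those of the current
    matrix, and 4 the number of qubits. Further, 5 is the component last read, 6 the bit last read
    in a unary number, 7 the number of entries left, 8 the index of the entry being written, 9 the
    number being written, and 10 the flag of the main loop. *)
Let X := if second then 2 else 0.
Let D := if second then 3 else 1.

Definition push :=
  assign X (computable_pair (computable_var 5) (computable_var X)).

Definition read_bit := SSeq (clear 5) (SRd 5).

Lemma exec_read_bit R (b : bool) i o :
  exec read_bit (R, b :: i, o) (upd R 5 b, i, o).
Proof.
apply: XSeq (exec_clear _ _ _ _) _.
by apply: exec_eq (XRd _ _ _ _ _) _ => r; rewrite upd_upd upd_at add0n.
Qed.

Lemma exec_push R i o : tidy R ->
  exec push (R, i, o) (upd R X (pair_code (R 5) (R X)), i, o).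
Proof.
by move=> h; apply: exec_assign => //; rewrite /X; case: (second).
Qed.

(** The denominator is the last component, so register 5 still holds it when the common denominator
    is updated. *)
Definition read_entry :=
  SSeq (SSeq read_bit push) (SSeq (SSeq (read_nat 5) push)
  (SSeq (SSeq read_bit push) (SSeq (SSeq (read_nat 5) push)
  (SSeq (SSeq (read_nat 5) push)
  (assign D (computable_mul (computable_var D)
                            (computable_succ (computable_var 5)))))))).

Lemma exec_read_entry R (g : gauss_rat) i o es : tidy R -> R 6 = 0 ->
  R X = list_code (rats_stack es) -> R D = dens es ->
  exec read_entry (R, gauss_rat_code g ++ i, o)
    (upd (upd (upd R 5 g.2) X (list_code (rats_stack (rcons es g))))
         D (dens (rcons es g)), i, o).
Proof.
case: g => [[a b] d] hR R6 RX RD.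
have X11 : X < 11 by rewrite /X; case: (second).
have X6 : 6 == X = false by rewrite /X; case: (second).
have X5 : 5 == X = false by rewrite /X; case: (second).
have D11 : D < 11 by rewrite /D; case: (second).
have DX : D == X = false by rewrite /D /X; case: (second).
have D5 : D == 5 = false by rewrite /D; case: (second).
have step c s R1 i1 i2 v : tidy R1 -> R1 6 = 0 -> R1 X = v ->
   exec c (R1, i1, o) (upd R1 5 s, i2, o) ->
   exec (SSeq c push) (R1, i1, o) (upd (upd R1 5 s) X (pair_code s v), i2, o) /\
   tidy (upd (upd R1 5 s) X (pair_code s v)) /\
   upd (upd R1 5 s) X (pair_code s v) 6 = 0 /\
   upd (upd R1 5 s) X (pair_code s v) X = pair_code s v.
  move=> t1 z1 v1 h; split; last first.
    split; first by do 2!apply: tidy_upd => //.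
    by rewrite upd_at /upd X6.
  apply: XSeq h _; apply: exec_eq (exec_push _ _ _) _; first exact: tidy_upd.
  by move=> r; rewrite upd_at -v1 {3}/upd eq_sym X5.
rewrite /= !int_codeE -!catA /=.
pose i4 := nat_code d ++ i; pose i3 := nat_code (int_cnt b) ++ i4.
pose i2 := nat_code (int_cnt a) ++ int_neg b :: i3.
have [h1 [t1 [z1 v1]]] :=
  step _ _ _ _ _ _ hR R6 RX (exec_read_bit R (int_neg a) i2 o).
have [h2 [t2 [z2 v2]]] := step _ _ _ _ _ _ t1 z1 v1
  (exec_read_nat (int_cnt a) (int_neg b :: i3) o (isT : 5 != 6) z1).
have [h3 [t3 [z3 v3]]] :=
  step _ _ _ _ _ _ t2 z2 v2 (exec_read_bit _ (int_neg b) i3 o).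
have [h4 [t4 [z4 v4]]] := step _ _ _ _ _ _ t3 z3 v3
  (exec_read_nat (int_cnt b) i4 o (isT : 5 != 6) z3).
have [h5 [t5 [z5 v5]]] := step _ _ _ _ _ _ t4 z4 v4
  (exec_read_nat d i o (isT : 5 != 6) z4).
apply: XSeq h1 _; apply: XSeq h2 _; apply: XSeq h3 _; apply: XSeq h4 _.
apply: XSeq h5 _.
apply: exec_eq (exec_assign _ _ _ D11 t5) _ => r.
rewrite /rats_stack rev_rcons /= /dens -cats1 big_cat big_seq1 -/(dens es) -RD.
rewrite /den /= /upd DX D5 X5 eqxx.
by case: (r =P D) => // _; case: (r =P X) => // _; case: (r =P 5).
Qed.

Definition read_loop := SWhile 7 (SSeq read_entry (SDec 7)).

Lemma exec_read_loop es R i o es0 : tidy R -> R 6 = 0 ->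
  R X = list_code (rats_stack es0) -> R D = dens es0 -> R 7 = size es ->
  exists R', exec read_loop (R, flatten (map gauss_rat_code es) ++ i, o)
      (R', i, o) /\
    [/\ tidy R', R' 6 = 0, R' X = list_code (rats_stack (es0 ++ es)),
        R' D = dens (es0 ++ es) &
        forall r, r \notin [:: X; D; 5; 7] -> R' r = R r].
Proof.
have X7 : 7 == X = false by rewrite /X; case: (second).
have X6 : 6 == X = false by rewrite /X; case: (second).
have X11 : X < 11 by rewrite /X; case: (second).
have D11 : D < 11 by rewrite /D; case: (second).
have D7 : 7 == D = false by rewrite /D; case: (second).
have D6 : 6 == D = false by rewrite /D; case: (second).
have XD : X == D = false by rewrite /D /X; case: (second).
elim: es es0 R => [|g es IH] es0 R hR R6 RX RD R7.
  by exists R; rewrite cats0; split => //; apply: XWhile0.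
pose R1 := upd (upd (upd (upd R 5 g.2) X (list_code (rats_stack (rcons es0 g))))
         D (dens (rcons es0 g))) 7 (size es).
have [|||||R' [h [t' z' x' d' f']]] := IH (rcons es0 g) R1.
- by do 4!apply: tidy_upd => //.
- by rewrite /R1 /upd /= D6 X6.
- by rewrite /R1 /upd [X == 7]eq_sym X7 XD eqxx.
- by rewrite /R1 /upd [D == 7]eq_sym D7 eqxx.
- by rewrite /R1 upd_at.
exists R'; rewrite -!cat_rcons; split; last first.
  split => // r hr; rewrite f' // /R1 /upd.
  by move: hr; rewrite !inE !negb_or => /and4P[/negbTE-> /negbTE-> /negbTE-> /negbTE->].
apply: XWhileS h; first by rewrite R7.
rewrite /= -catA; apply: XSeq; first exact: exec_read_entry RX RD.
apply: exec_eq (XDec _ _ _ _) _ => r; rewrite /R1 /upd D7 X7 /= R7.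
by case: (r =P 7).
Qed.

Definition read_mx :=
  SSeq (clear X) (SSeq (assign D (computable_const 1)) (SSeq (read_nat 4)
  (SSeq (assign 7 (computable_mul (computable_exp2 (computable_var 4))
                                  (computable_exp2 (computable_var 4))))
        read_loop))).

Definition rats_code n (es : seq gauss_rat) :=
  nat_code n ++ flatten (map gauss_rat_code es).

Lemma exec_read_mx n es R i o : tidy R -> R 6 = 0 -> size es = 2 ^ n * 2 ^ n ->
  exists R', exec read_mx (R, rats_code n es ++ i, o) (R', i, o) /\
    [/\ tidy R', R' 6 = 0 /\ R' 4 = n, R' X = list_code (rats_stack es),
        R' D = dens es &
        forall r, r \notin [:: X; D; 4; 5; 7] -> R' r = R r].
Proof.
move=> hR R6 hs.
have X11 : X < 11 by rewrite /X; case: (second).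
have D11 : D < 11 by rewrite /D; case: (second).
have D6 : 6 == D = false by rewrite /D; case: (second).
have X6 : 6 == X = false by rewrite /X; case: (second).
pose R1 := upd (upd (upd (upd R X 0) D 1) 4 n) 7 (2 ^ n * 2 ^ n).
have [|||||R' [h [t' z' x' d' f']]] := @exec_read_loop es R1 i o [::].
- by do 4!apply: tidy_upd => //.
- by rewrite /R1 /upd /= D6 X6.
- by rewrite /R1 /upd /X /D; case: (second).
- by rewrite /R1 /upd /X /D /dens big_nil; case: (second).
- by rewrite /R1 upd_at.
exists R'; split; last first.
  split => //; first by split => //; rewrite f' ?/R1 ?/upd // /X /D; case: (second).
  move=> r; rewrite !inE !negb_or => /and5P[h1 h2 h3 h4 h5]; rewrite f'.
    by rewrite /R1 /upd (negbTE h1) (negbTE h2) (negbTE h3) (negbTE h5).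
  by rewrite !inE !negb_or h1 h2 h4 h5.
rewrite /rats_code -catA; apply: XSeq (exec_clear _ _ _ _) _.
apply: XSeq; first by apply: exec_assign => //; apply: tidy_upd.
apply: XSeq; first by apply: exec_read_nat => //; rewrite /upd D6 X6.
apply: XSeq h; apply: exec_assign => //; by do 3!apply: tidy_upd => //.
Qed.

End Reading.

End Program.

(** * Writing the conjugated matrices, and the main loop *)

Section Emission.
Local Open Scope nat_scope.
Variable adj : bool.

Definition env_entry (env : nat -> nat) : gint :=
  conj_entry adj (env 0) (env 1) (env 2) (env 3) (env 4) (env 8).

Lemma computable_neg (p n : (nat -> nat) -> nat) :
  computable p -> computable n ->
  computable (fun env => dint_neg (p env, n env) : nat).
Proof. by move=> hp hn; apply: computable_leq => //; exact: computable_succ. Qed.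

Lemma computable_abs (p n : (nat -> nat) -> nat) :
  computable p -> computable n ->
  computable (fun env => dint_abs (p env, n env)).
Proof.
move=> hp hn; apply: computable_add; first exact: computable_sub.
by apply: computable_pred; exact: computable_sub.
Qed.

Section EmitEntry.
Variables (G : (nat -> nat) -> gint) (d : (nat -> nat) -> nat).
Hypotheses (hG : computable_gint G) (hd : computable d).
(** Register 9 receives the components one after the other, so the values being written must not
    depend on it. *)
Hypothesis G9 : forall R v, G (upd R 9 v) = G R.
Hypothesis d9 : forall R v, d (upd R 9 v) = d R.

Definition emit_rat :=
  SSeq (assign 9 (computable_neg hG.1.1 hG.1.2)) (SSeq (SEmit 9)
  (SSeq (assign 9 (computable_abs hG.1.1 hG.1.2)) (SSeq (emit_nat 9)
  (SSeq (assign 9 (computable_neg hG.2.1 hG.2.2)) (SSeq (SEmit 9)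
  (SSeq (assign 9 (computable_abs hG.2.1 hG.2.2)) (SSeq (emit_nat 9)
  (SSeq (assign 9 (computable_pred hd)) (emit_nat 9))))))))).

Lemma exec_emit_rat R i o : tidy R ->
  exec emit_rat (R, i, o)
    (upd R 9 0, i, o ++ gauss_rat_code (gint_rat (G R) (d R))).
Proof.
move=> hR; have t v : tidy (upd R 9 v) by apply: tidy_upd.
apply: XSeq; first exact: exec_assign.
apply: XSeq; first exact: XEmit.
apply: XSeq; first exact: exec_assign.
rewrite upd_upd G9 upd_at.
apply: XSeq; first exact: exec_emit_nat.
rewrite upd_upd upd_at.
apply: XSeq; first exact: exec_assign.
rewrite upd_upd G9.
apply: XSeq; first exact: XEmit.
rewrite upd_at.
apply: XSeq; first exact: exec_assign.
rewrite upd_upd G9.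
apply: XSeq; first exact: exec_emit_nat.
rewrite upd_upd upd_at.
apply: XSeq; first exact: exec_assign.
rewrite upd_upd d9.
have nb (b : bool) : ((b : nat) != 0) = b by case: b.
have := exec_emit_nat 9 (upd R 9 (d R).-1) i.
rewrite upd_upd upd_at !nb -!surjective_pairing => h.
have -> : o ++ gauss_rat_code (gint_rat (G R) (d R)) =
  rcons (rcons o (dint_neg (G R).1) ++ nat_code (dint_abs (G R).1))
    (dint_neg (G R).2) ++ nat_code (dint_abs (G R).2) ++ nat_code (d R).-1.
  by rewrite /gauss_rat_code /gint_rat !dint_int_code !cat_rcons -!catA /= ?cat_rcons -?catA.
by rewrite catA; exact: h.
Qed.

End EmitEntry.

Let den_computable : computable (fun env => env 1 * env 1 * env 3) :=
  computable_mul (computable_mul (computable_var 1) (computable_var 1))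
    (computable_var 3).

Definition emit_entry := emit_rat (computable_conj_entry adj) den_computable.

Lemma exec_emit_entry R i o : tidy R ->
  exec emit_entry (R, i, o) (upd R 9 0, i,
    o ++ gauss_rat_code (gint_rat (env_entry R) (R 1 * R 1 * R 3))).
Proof. by move=> hR; apply: exec_emit_rat. Qed.

Definition emit_loop := SWhile 7 (SSeq emit_entry (SSeq (SInc 8) (SDec 7))).

Definition entry_code (LA DA LR DR n e : nat) : seq bool :=
  gauss_rat_code (gint_rat (conj_entry adj LA DA LR DR n e) (DA * DA * DR)).

Lemma exec_emit_loop k R i o : tidy R -> R 7 = k ->
  exists R', exec emit_loop (R, i, o) (R', i,
      o ++ flatten [seq entry_code (R 0) (R 1) (R 2) (R 3) (R 4) e
                   | e <- iota (R 8) k]) /\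
    tidy R' /\ forall r, r \notin [:: 7; 8; 9] -> R' r = R r.
Proof.
elim: k R o => [|k IH] R o hR R7.
  by exists R; rewrite cats0; split => //; apply: XWhile0.
pose R1 := upd (upd (upd R 9 0) 8 (R 8).+1) 7 k.
have [||R' [h [t' f']]] := IH R1 (o ++ entry_code (R 0) (R 1) (R 2) (R 3) (R 4) (R 8)).
- by do 3!apply: tidy_upd => //.
- by rewrite /R1 upd_at.
exists R'; split; last first.
  split => // r hr; rewrite f' // /R1 /upd.
  by move: hr; rewrite !inE !negb_or => /and3P[/negbTE-> /negbTE-> /negbTE->].
move: h => /=; rewrite -catA => h; apply: XWhileS h; first by rewrite R7.
apply: XSeq; first exact: exec_emit_entry.
apply: XSeq; first exact: XInc.
by apply: exec_eq (XDec _ _ _ _) _ => r; rewrite /R1 /upd /= R7.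
Qed.

Definition emit_mx :=
  SSeq (assign 9 (computable_var 4)) (SSeq (emit_nat 9)
  (SSeq (assign 7 (computable_mul (computable_exp2 (computable_var 4))
                                  (computable_exp2 (computable_var 4))))
  (SSeq (clear 8) emit_loop))).

Lemma exec_emit_mx R i o : tidy R ->
  exists R', exec emit_mx (R, i, o) (R', i,
      o ++ nat_code (R 4) ++
      flatten (mkseq (entry_code (R 0) (R 1) (R 2) (R 3) (R 4))
                 (2 ^ R 4 * 2 ^ R 4))) /\
    tidy R' /\ forall r, r \notin [:: 7; 8; 9] -> R' r = R r.
Proof.
move=> hR; pose N := 2 ^ R 4 * 2 ^ R 4.
pose R1 := upd (upd (upd R 9 0) 7 N) 8 0.
have [||R' [h [t' f']]] := @exec_emit_loop N R1 i (o ++ nat_code (R 4)).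
- by do 3!apply: tidy_upd => //.
- by rewrite /R1 /upd.
exists R'; split; last first.
  split => // r hr; rewrite f' // /R1 /upd.
  by move: hr; rewrite !inE !negb_or => /and3P[/negbTE-> /negbTE-> /negbTE->].
rewrite catA.
apply: XSeq; first exact: exec_assign.
apply: XSeq; first exact: exec_emit_nat.
rewrite upd_upd upd_at.
apply: XSeq; first by apply: exec_assign => //; apply: tidy_upd.
apply: XSeq; first exact: exec_clear.
exact: h.
Qed.

Definition main_loop := SSeq (read_mx true) emit_mx.
Definition main := SSeq (SSeq (read_mx false) (SInc 10)) (SWhile 10 main_loop).

Definition conj_rats n (esA es : seq gauss_rat) : seq gauss_rat :=
  mkseq (fun e => gint_rat
    (conj_entry adj (list_code (rats_stack esA)) (dens esA)
       (list_code (rats_stack es)) (dens es) n e)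
    (dens esA * dens esA * dens es)) (2 ^ n * 2 ^ n).

(** Register 10 stays at 1 and [main] never ends, so the claim is about a finite input: once it is
    consumed, control is back at the test of the endless loop and all conjugated matrices have been
    written. *)
Lemma main_steps n esA (ess : seq (seq gauss_rat)) :
  size esA = 2 ^ n * 2 ^ n ->
  (forall es, es \in ess -> size es = 2 ^ n * 2 ^ n) ->
  exists pc R, csteps (compile main 0) 0
    (fun=> 0, rats_code n esA ++ flatten (map (rats_code n) ess), [::]) pc
    (R, [::], flatten (map (rats_code n \o conj_rats n esA) ess)).
Proof.
move=> sA sz; set C := compile main 0.
pose s0 := SSeq (read_mx false) (SInc 10); pose pre := compile s0 0.
have CE : C = pre ++ compile (SWhile 10 main_loop) (size pre) ++ [::].
  by rewrite cats0.
pose good (R : regs) := [/\ tidy R, R 6 = 0, R 10 = 1,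
  R 0 = list_code (rats_stack esA) & R 1 = dens esA].
have once R es i o : good R -> size es = 2 ^ n * 2 ^ n ->
    exists R', exec main_loop (R, rats_code n es ++ i, o)
      (R', i, o ++ rats_code n (conj_rats n esA es)) /\ good R'.
  move=> [t z6 z10 z0 z1] hs.
  have [R1 [h1 [t1 [u6 u4] u2 u3 f1]]] := exec_read_mx true i o t z6 hs.
  have [R2 [h2 [t2 f2]]] := exec_emit_mx i o t1.
  exists R2; split; last first.
    by split => //; rewrite f2 // f1.
  apply: XSeq h1 _; move: h2; rewrite u4 u2 u3 !f1 // z0 z1.
  by rewrite /rats_code /conj_rats /mkseq -map_comp.
have flat (x : seq bool) s : flatten (x :: s) = x ++ flatten s by [].
have loop i : forall R o, good R ->
    (forall es, es \in i -> size es = 2 ^ n * 2 ^ n) ->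
    exists R', csteps C (size pre) (R, flatten (map (rats_code n) i), o)
      (size pre)
      (R', [::], o ++ flatten (map (rats_code n \o conj_rats n esA) i)).
  elim: i => [|es i IH] R o gR hi.
    by exists R; rewrite cats0; exact: CRefl.
  have [|R1 [h1 g1]] := once R es (flatten (map (rats_code n) i)) o gR.
    by apply: hi; rewrite mem_head.
  have [|R2 h2] := IH R1 (o ++ rats_code n (conj_rats n esA es)) g1.
    by move=> x hx; apply: hi; rewrite inE hx orbT.
  exists R2; rewrite !map_cons !flat catA; apply: csteps_trans h2.
  apply: compile_loop CE; first by have [_ _ -> _ _] := gR.
  exact: compile_correct h1.
have t0 : tidy (fun=> 0) by [].
have [R1 [h1 [t1 [u6 u4] u2 u3 f1]]] :=
  exec_read_mx false (flatten (map (rats_code n) ess)) [::] t0 erefl sA.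
have [|R2 h2] := loop ess (upd R1 10 (R1 10).+1) [::] _ sz.
  by split => //; [apply: tidy_upd | rewrite upd_at f1].
exists (size pre), R2; apply: csteps_trans h2.
have hx := XSeq h1 (XInc 10 _ _ _).
have := compile_correct hx (C := C) (pre := [::]).
by rewrite add0n; apply; exact: CE.
Qed.

End Emission.

(** * Matrices and their codes *)

Section MatrixCode.
Local Open Scope nat_scope.

Lemma nth_allpairs_mul (S T V : Type) (f : S -> T -> V) s t x y z i j :
  i < size s -> j < size t ->
  nth z [seq f u v | u <- s, v <- t] (i * size t + j) =
  f (nth x s i) (nth y t j).
Proof.
move=> hi hj; elim: s i hi => [|u s IH] [|i] //= hi.
  by rewrite nth_cat size_map hj (nth_map y).
rewrite nth_cat size_map ifF; last by rewrite mulSn; lia.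
by rewrite -IH //; congr nth; rewrite mulSn; lia.
Qed.

Definition mx_entries n (r : 'M[gauss_rat]_(2 ^ n)) : seq gauss_rat :=
  [seq r i j | i <- enum 'I_(2 ^ n), j <- enum 'I_(2 ^ n)].

Lemma mx_codeE n (r : 'M[gauss_rat]_(2 ^ n)) :
  mx_code r = rats_code n (mx_entries r).
Proof. by rewrite /mx_code /rats_code map_allpairs. Qed.

Lemma size_mx_entries n (r : 'M[gauss_rat]_(2 ^ n)) :
  size (mx_entries r) = 2 ^ n * 2 ^ n.
Proof. by rewrite size_allpairs size_enum_ord. Qed.

Lemma nth_mx_entries n (r : 'M[gauss_rat]_(2 ^ n)) x0 (i j : 'I_(2 ^ n)) :
  nth x0 (mx_entries r) (i * 2 ^ n + j) = r i j.
Proof.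
have e : size (enum 'I_(2 ^ n)) = 2 ^ n by rewrite size_enum_ord.
have := @nth_allpairs_mul _ _ _ (fun u v => r u v) (enum 'I_(2 ^ n))
  (enum 'I_(2 ^ n)) i j x0 i j.
by rewrite e => -> //; rewrite !nth_ord_enum.
Qed.

Definition rats_mx n (s : seq gauss_rat) : 'M[gauss_rat]_(2 ^ n) :=
  \matrix_(i, j) nth (0%R, 0%R, 0) s (i * 2 ^ n + j).

Lemma rats_mxK n s : size s = 2 ^ n * 2 ^ n -> mx_entries (rats_mx n s) = s.
Proof.
move=> hs; apply: (@eq_from_nth _ (0%R, 0%R, 0)); rewrite size_mx_entries //.
move=> e he; have m0 : 0 < 2 ^ n by rewrite expn_gt0.
have hi : e %/ 2 ^ n < 2 ^ n by rewrite ltn_divLR.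
have hj : e %% 2 ^ n < 2 ^ n by rewrite ltn_mod.
rewrite {1}(divn_eq e (2 ^ n)).
by rewrite (nth_mx_entries _ _ (Ordinal hi) (Ordinal hj)) mxE /= -divn_eq.
Qed.

Definition conj_mx adj n (A r : 'M[gauss_rat]_(2 ^ n)) : 'M[gauss_rat]_(2 ^ n) :=
  rats_mx n (conj_rats adj n (mx_entries A) (mx_entries r)).

Lemma conj_mx_code adj n (A r : 'M[gauss_rat]_(2 ^ n)) :
  mx_code (conj_mx adj A r) =
  rats_code n (conj_rats adj n (mx_entries A) (mx_entries r)).
Proof. by rewrite mx_codeE rats_mxK // size_mkseq. Qed.

Definition adjoint_if (R : realType) (adj : bool) m (A : 'M[R[i]]_m) :=
  (if adj then A ^t* else A)%R.

(** The equality is exact: two factors of A and one of r put [DA * DA * DR] into every numerator,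
    and the denominator cancels it. *)
Lemma conj_mx_val (R : realType) adj n (A r : 'M[gauss_rat]_(2 ^ n)) :
  let B := adjoint_if adj (mx_val R A) in
  (mx_val R (conj_mx adj A r) = B *m mx_val R r *m B ^t* )%R.
Proof.
move=> B; have m0 : 0 < 2 ^ n by rewrite expn_gt0.
set DA := dens (mx_entries A); set DR := dens (mx_entries r).
have idx (i j : 'I_(2 ^ n)) : i * 2 ^ n + j < 2 ^ n * 2 ^ n.
  by have := ltn_ord i; have := ltn_ord j; nia.
have entE (M : 'M[gauss_rat]_(2 ^ n)) (i j : 'I_(2 ^ n)) :
    (gint_val R (entry (list_code (rats_stack (mx_entries M)))
       (2 ^ n * 2 ^ n) (dens (mx_entries M)) (i * 2 ^ n + j)) =
     (dens (mx_entries M))%:R * mx_val R M i j)%R.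
  rewrite -(size_mx_entries M) (entryE R (0%R, 0%R, 0)) ?size_mx_entries //.
  by rewrite nth_mx_entries mxE.
have facE (i k : 'I_(2 ^ n)) :
    (gint_val R (factor adj (list_code (rats_stack (mx_entries A))) DA n i k) =
     DA%:R * B i k)%R.
  rewrite /factor /B /adjoint_if; case: (adj); last exact: entE.
  by rewrite gint_val_conj entE !mxE rmorphM /= rmorph_nat.
apply/matrixP => i j; rewrite !mxE nth_mkseq // gint_ratE; last first.
  by rewrite !muln_gt0 !dens_gt0.
rewrite /conj_entry quotientE // divnMDl // divn_small // addn0 addKn.
rewrite gint_val_sum.
have DA0 : (DA%:R != 0 :> R[i])%R by rewrite pnatr_eq0 -lt0n dens_gt0.
have DR0 : (DR%:R != 0 :> R[i])%R by rewrite pnatr_eq0 -lt0n dens_gt0.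
transitivity (\sum_(k < 2 ^ n) \sum_(l < 2 ^ n)
   B i k * mx_val R r k l * (B j l)^* )%R; last first.
  rewrite exchange_big /=; apply: eq_bigr => l _.
  by rewrite !mxE mulr_suml.
rewrite mulr_suml; apply: eq_bigr => k _.
rewrite gint_val_sum mulr_suml; apply: eq_bigr => l _.
rewrite !gint_val_mul gint_val_conj facE facE entE rmorphM /= rmorph_nat.
rewrite !natrM; set b := (B j l)^*%C.
by field; rewrite DA0 DR0.
Qed.

End MatrixCode.

(** For each [k] the counter program is run on the code of [A] followed by the first [k] matrices
    only. *)
Lemma outputs_conj (U : machine) adj n
    (A : 'M[gauss_rat]_(2 ^ n)) (r : nat -> 'M[gauss_rat]_(2 ^ n)) q :
  outputs_sequence U (mx_code A) q (fun k => mx_code (r k)) ->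
  outputs_sequence (pipe U (compile (main adj) 0)) (mx_code A) q
    (fun k => mx_code (conj_mx adj A (r k))).
Proof.
move=> h k; have sA := size_mx_entries A.
have [|pc [R' hs]] := @main_steps adj n (mx_entries A)
  (mkseq (fun k => mx_entries (r k)) k) sA.
  by move=> es /mapP[j _ ->]; exact: size_mx_entries.
have -> : flatten (mkseq (fun k => mx_code (conj_mx adj A (r k))) k) =
    flatten [seq (rats_code n \o conj_rats adj n (mx_entries A)) i
            | i <- mkseq (fun k => mx_entries (r k)) k].
  rewrite /mkseq -map_comp; congr flatten; apply: eq_map => j /=.
  exact: conj_mx_code.
apply: pipe_emits hs; first exact: (h k).
rewrite -mx_codeE /mkseq -map_comp.
rewrite (eq_map (g := fun j => mx_code (r j))) ?prefix_refl //.
by move=> j /=; rewrite mx_codeE.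
Qed.

(** * Prefix machines and codes *)

Section Prepend.
Local Open Scope nat_scope.
Variables (b : bool) (M : machine).

Definition prepend_trans (q : option (state M)) (y a : option bool)
    (s : {ffun 'I_(ntapes M) -> symbol M}) :
    action (option (state M)) (symbol M) (ntapes M) :=
  match q with
  | None => Act (Some (start M)) Stay Stay [ffun i => (s i, Stay)] (Some b)
  | Some q =>
    match trans q y a s with
    | Halt => Halt
    | Read f => Read _ _ (fun b => Some (f b))
    | Act q' d1 d2 w o => Act (Some q') d1 d2 w o
    end
  end.

Definition prepend : machine :=
  @Machine (option (state M)) (symbol M) (blank M) (ntapes M) None prepend_trans.

Definition prepend_config (c : config M) : config prepend :=
  @Config prepend (Some (cstate c)) (unread c) (cond_tape c) (oracle_tape c)
    (work c) (b :: out c).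

Lemma prepend_step c : step (prepend_config c) = prepend_config (step c).
Proof.
rewrite /step /next_action /=.
by case: trans => [|f|q d1 d2 w o] //=; case: (unread c).
Qed.

Lemma prepend_run a y p t :
  run prepend a y p t.+1 = prepend_config (run M a y p t).
Proof.
elim: t => [|t IH]; last by rewrite /run iterS -/(run _ _ _ _ _) IH prepend_step.
rewrite /run /= /step /=; congr Config; try exact: shift_stay.
by apply/funext => i; rewrite !ffunE shift_stay; exact: (write_scan (_, fun=> blank M)).
Qed.

Lemma prepend_computes a y p x :
  computes M a y p x -> computes prepend a y p (b :: x).
Proof.
move=> [t [h1 h2 h3]]; exists t.+1; rewrite prepend_run; split => //=.
  by move: h1; rewrite /next_action /= => ->.
by rewrite h3.
Qed.

End Prepend.

(** Applied to [U], this turns every program for q into a program for e ++ q on another machine, at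
    no cost in length. *)
Lemma exists_prepend (M : machine) (e : seq bool) : exists T : machine,
  forall a y p x, computes M a y p x -> computes T a y p (e ++ x).
Proof.
elim: e => [|b e [T hT]]; first by exists M.
by exists (prepend b T) => a y p x h; apply/prepend_computes/hT.
Qed.

(** * Halting programs form a prefix-free set *)

Section Determinism.
Local Open Scope nat_scope.
Variables (M : machine) (a y : seq bool).

Definition add_input (s : seq bool) (c : config M) : config M :=
  Config (cstate c) (unread c ++ s) (cond_tape c) (oracle_tape c) (work c)
    (out c).

Lemma run_stuck p t t' : t <= t' -> step (run M a y p t) = run M a y p t ->
  run M a y p t' = run M a y p t.
Proof.
by move=> h e; rewrite -(subnK h) /run iterD -/(run M a y p t) iter_fix.
Qed.

Lemma add_input_run p s t : next_action (run M a y p t) = Halt ->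
  forall t', t' <= t -> run M a y (p ++ s) t' = add_input s (run M a y p t').
Proof.
move=> ht; elim=> [//|t' IH] h.
rewrite /run !iterS -!/(run _ _ _ _ _) IH 1?ltnW //.
set c := run M a y p t'.
rewrite {1}/step /next_action /= -/(next_action c).
case E : (next_action c) => [|f|q d1 d2 w o]; rewrite /step E //.
case Eu : (unread c) => [|b' u] //=.
(* A [Read] with no input left freezes the run, against the later [Halt]. *)
have e : step c = c by rewrite /step E Eu.
by move: ht; rewrite (run_stuck (ltnW h) e) -/c E.
Qed.

(** A computation that halts on [p] never reads beyond it, so on p ++ s it halts with [s] unread.
    This gives prefix-freeness and uniqueness of the result at once. *)
Lemma computes_prefix p s x x' :
  computes M a y p x -> computes M a y (p ++ s) x' -> s = [::] /\ x = x'.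
Proof.
move=> [t [h1 h2 h3]] [t' [h1' h2' h3']].
have e := add_input_run s h1 (leqnn t).
have h1'' : next_action (run M a y (p ++ s) t) = Halt by rewrite e.
have fix1 : step (run M a y (p ++ s) t) = run M a y (p ++ s) t.
  by rewrite {1}/step h1''.
have fix2 : step (run M a y (p ++ s) t') = run M a y (p ++ s) t'.
  by rewrite {1}/step h1'.
have ee : run M a y (p ++ s) t = run M a y (p ++ s) t'.
  by case: (leqP t t') => [/run_stuck-> //|/ltnW/run_stuck->].
by move: h2' h3'; rewrite -ee e /= h2 /= h3 => -> ->.
Qed.

Lemma out_prefix p t t' : t <= t' ->
  prefix (out (run M a y p t)) (out (run M a y p t')).
Proof.
move=> h; rewrite -(subnK h); elim: (t' - t) => [|n IH]; first exact: prefix_refl.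
apply: prefix_trans IH _; rewrite addSn.
have -> : run M a y p (n + t).+1 = step (run M a y p (n + t)) by [].
by have [s ->] := out_step (run M a y p (n + t)); rewrite prefix_prefix.
Qed.

Lemma emits_comparable p w w' : emits M a y p w -> emits M a y p w' ->
  exists u u', w ++ u = w' ++ u'.
Proof.
move=> [t h] [t' h'].
have [u e] := prefixP (prefix_trans h (out_prefix p (leq_maxl t t'))).
have [u' e'] := prefixP (prefix_trans h' (out_prefix p (leq_maxr t t'))).
by exists u, u'; rewrite -e -e'.
Qed.

End Determinism.

(** * Kraft's inequality *)

Section Kraft.
Variable R : realType.

(** Induction on the maximal length: strings are split by their first bit, and removing it leaves
    two prefix-free sets whose weights have doubled. The empty string can only occur alone. *)
Lemma kraft_fin n (s : seq (seq bool)) :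
  (forall p, p \in s -> (size p <= n)%N) -> uniq s ->
  (forall p q, p \in s -> q \in s -> prefix p q -> p = q) ->
  \sum_(p <- s) 2%:R ^- size p <= 1 :> R.
Proof.
elim: n s => [|n IH] s hs us ps; have [s0|s0] := boolP ([::] \in s).
- have : s = [:: [::]].
    apply: perm_small_eq => //; apply: uniq_perm => // p; rewrite inE.
    by apply/idP/eqP => [hp|-> //]; rewrite -(ps _ _ s0 hp (prefix0s _)).
  by move->; rewrite big_seq1 expr0 invr1.
- have -> : s = [::]; last by rewrite big_nil.
  case: s s0 hs {us ps} => // p s s0 /(_ p (mem_head _ _)).
  by rewrite leqn0 size_eq0 => /eqP p0; rewrite p0 mem_head in s0.
- have : s = [:: [::]].
    apply: perm_small_eq => //; apply: uniq_perm => // p; rewrite inE.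
    by apply/idP/eqP => [hp|-> //]; rewrite -(ps _ _ s0 hp (prefix0s _)).
  by move->; rewrite big_seq1 expr0 invr1.
(* The empty string is excluded here, so the default value of [head] is never taken. *)
pose part b := [seq behead p | p <- s & head false p == b].
have partE b p : (p \in part b) = (b :: p \in s).
  apply/mapP/idP => [[q]|h]; last by exists (b :: p) => //; rewrite mem_filter eqxx.
  rewrite mem_filter => /andP[/eqP qb qs] ->.
  by case: q qb qs => [|c q] /= <- //; rewrite (negbTE s0).
have partP b : \sum_(p <- part b) 2%:R ^- size p <= 1 :> R.
  apply: IH.
  - by move=> p; rewrite partE => /hs.
  - rewrite map_inj_in_uniq ?filter_uniq // => p q.
    rewrite !mem_filter => /andP[/eqP pb p_s] /andP[/eqP qb qs].
    case: p pb p_s => [|c p] /=; first by rewrite (negbTE s0).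
    case: q qb qs => [|d q] /=; first by rewrite (negbTE s0).
    by move=> -> _ -> _ ->.
  - move=> p q; rewrite !partE => hp hq hpq.
    have h : prefix (b :: p) (b :: q) by rewrite prefix_cons eqxx.
    by case: (ps _ _ hp hq h).
have half b : \sum_(p <- s | head false p == b) 2%:R ^- size p =
    2%:R^-1 * \sum_(p <- part b) 2%:R ^- size p :> R.
  rewrite big_map big_filter mulr_sumr big_seq_cond [RHS]big_seq_cond.
  apply: eq_bigr => -[|c p] /andP[hp _]; first by rewrite (negbTE s0) in hp.
  by rewrite /= exprS invfM.
rewrite (bigID (fun p => head false p == true)) /= half.
rewrite (eq_bigl (fun p => head false p == false)); last by move=> p; case: head.
rewrite half -mulrDr; have := partP true; have := partP false; lra.
Qed.

End Kraft.

(** * Codes are self-delimiting, so a program determines its matrix *)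

Section CodeUniqueness.
Local Open Scope nat_scope.

Lemma nat_code_inj k k' u u' :
  nat_code k ++ u = nat_code k' ++ u' -> k = k' /\ u = u'.
Proof.
rewrite /nat_code; elim: k k' => [|k IH] [|k'] //= [] // h.
by have [-> ->] := IH _ h.
Qed.

Lemma int_code_inj z z' u u' :
  int_code z ++ u = int_code z' ++ u' -> z = z' /\ u = u'.
Proof.
by case: z z' => k [] k' //= [] /nat_code_inj[-> ->].
Qed.

Lemma gauss_rat_code_inj x x' u u' :
  gauss_rat_code x ++ u = gauss_rat_code x' ++ u' -> x = x' /\ u = u'.
Proof.
case: x x' => [[a b] d] [[a' b'] d'] /=; rewrite -!catA.
by move=> /int_code_inj[-> /int_code_inj[-> /nat_code_inj[-> ->]]].
Qed.

Lemma rats_code_inj n es es' u u' : size es = size es' ->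
  rats_code n es ++ u = rats_code n es' ++ u' -> es = es' /\ u = u'.
Proof.
rewrite /rats_code -!catA => + /nat_code_inj[_].
elim: es es' => [|x es IH] [|x' es'] //= [hs].
by rewrite -!catA => /gauss_rat_code_inj[-> /(IH _ hs)[-> ->]].
Qed.

Lemma mx_code_inj n (r r' : 'M[gauss_rat]_(2 ^ n)) u u' :
  mx_code r ++ u = mx_code r' ++ u' -> r = r' /\ u = u'.
Proof.
rewrite !mx_codeE => /rats_code_inj; rewrite !size_mx_entries => -[//|e ->].
split => //; apply/matrixP => i j.
by rewrite -(nth_mx_entries r (0%R, 0%R, 0)) e nth_mx_entries.
Qed.

(** Two outputs of one program are initial segments of a common string, which decodes in a single
    way; k + 1 codewords reach index k. *)
Lemma outputs_sequence_inj (U : machine) a q n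
    (r r' : nat -> 'M[gauss_rat]_(2 ^ n)) :
  outputs_sequence U a q (fun k => mx_code (r k)) ->
  outputs_sequence U a q (fun k => mx_code (r' k)) -> r = r'.
Proof.
move=> h h'; apply/funext => k.
have [u [u']] := emits_comparable (h k.+1) (h' k.+1).
have flat m (F G : nat -> 'M[gauss_rat]_(2 ^ n)) v v' :
    flatten (map (fun k => mx_code (F k)) m) ++ v =
    flatten (map (fun k => mx_code (G k)) m) ++ v' -> {in m, F =1 G}.
  elim: m => //= x m IH hm z.
  have /mx_code_inj[e /IH e'] :=
    etrans (catA _ _ _) (etrans hm (esym (catA _ _ _))).
  by rewrite inE => /orP[/eqP -> //|/e'].
by move=> /flat; apply; rewrite mem_iota ltnS leqnn.
Qed.

End CodeUniqueness.

Lemma lower_computes_inj (R : realType) (U : machine) a n q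
    (S S' : 'M[R[i]]_(2 ^ n)) :
  lower_computes U a q S -> lower_computes U a q S' -> S = S'.
Proof.
move=> [_ [r [h1 _ _ c1]]] [_ [r2 [h2 _ _ c2]]].
rewrite -(outputs_sequence_inj h1 h2) in c2.
apply/matrixP => i j; apply/eqP; rewrite eq_complex.
have [re1 im1] := c1 i j; have [re2 im2] := c2 i j.
by rewrite (cvg_unique _ re1 re2) // (cvg_unique _ im1 im2) // !eqxx.
Qed.

(** * Positive semidefinite matrices *)

Section Psd.
Variable R : realType.
Local Notation C := R[i].

Lemma trmxC_mul m n p (A : 'M[C]_(m, n)) (B : 'M[C]_(n, p)) :
  (A *m B) ^t* = B ^t* *m A ^t*.
Proof. by rewrite trmx_mul map_mxM. Qed.

Lemma psdmx_conj m n (B : 'M[C]_(m, n)) (A : 'M[C]_n) : psdmx A ->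
  psdmx (B *m A *m B ^t* ).
Proof.
move=> [hA pA]; split; first by rewrite !trmxC_mul trmxCK hA mulmxA.
by move=> u; have := pA (u *m B); rewrite trmxC_mul !mulmxA.
Qed.

Lemma psdmx_diag n (A : 'M[C]_n) i : psdmx A -> 0 <= A i i.
Proof.
move=> [_ /(_ (delta_mx 0 i))].
rewrite -rowE !mxE (bigD1 i) //= big1 ?addr0 => [|j ji].
  by rewrite !mxE !eqxx conjC1 mulr1.
by rewrite !mxE eqxx (negbTE ji) conjC0 mulr0.
Qed.

(** Diagonalizing B turns the trace into a sum of eigenvalues of B times diagonal entries of a
    unitary conjugate of A, all of them nonnegative. *)
Lemma psdmx_tr_mul n (A B : 'M[C]_n) : psdmx A -> psdmx B -> 0 <= \tr (A *m B).
Proof.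
move=> hA [hB pB].
have nB : B \is normalmx by apply/normalmxP; rewrite hB.
have /orthomx_spectralP BE := nB.
set P := spectralmx B in BE; set d := spectral_diag B in BE.
have uP : P \is unitarymx := spectral_unitarymx B.
rewrite (invmx_unitary uP) in BE.
have PP : P *m P ^t* = 1%:M by apply/unitarymxP.
have dE : P *m B *m P ^t* = diag_mx d.
  by rewrite BE !mulmxA PP mul1mx -mulmxA PP mulmx1.
have d0 k : 0 <= d 0 k.
  have : psdmx (diag_mx d) by rewrite -dE; apply: psdmx_conj.
  by move=> /(psdmx_diag k); rewrite mxE eqxx mulr1n.
have -> : \tr (A *m B) = \tr (P *m A *m P ^t* *m diag_mx d).
  by rewrite {1}BE !mulmxA mxtrace_mulC !mulmxA.
apply: sumr_ge0 => k _; rewrite mul_mx_diag mxE mulr_ge0 //.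
exact: psdmx_diag (psdmx_conj P hA).
Qed.

(** Off the diagonal, the quadratic form at e_i + z e_j with z = 1, -1, i, -i bounds twice the real
    and imaginary parts by A_ii + A_jj, which is at most the trace. *)
Lemma psdmx_entry n (A : 'M[C]_n) i j : psdmx A ->
  `|complex.Re (A i j)| <= complex.Re (\tr A) /\
  `|complex.Im (A i j)| <= complex.Re (\tr A).
Proof.
move=> hA; have [hh pA] := hA.
have trE : complex.Re (\tr A) = \sum_k complex.Re (A k k).
  by rewrite /mxtrace raddf_sum.
have Re0 k : 0 <= complex.Re (A k k).
  by have := psdmx_diag k hA; rewrite lecE => /andP[].
have Aji : A j i = (A i j)^*.
  by rewrite -{1}hh !mxE.
have [<-|ij] := eqVneq i j.
  have Im0 : complex.Im (A i i) = 0.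
    by have := psdmx_diag i hA; rewrite lecE => /andP[/eqP].
  rewrite Im0 normr0 ger0_norm // trE; split; last exact: sumr_ge0.
  by rewrite (bigD1 i) //= lerDl sumr_ge0.
have tr2 : complex.Re (A i i) + complex.Re (A j j) <= complex.Re (\tr A).
  rewrite trE (bigD1 i) //= (bigD1 j) 1?eq_sym //= addrA lerDl.
  exact: sumr_ge0.
pose e k : 'rV[C]_n := delta_mx 0 k.
have form k l : (e k *m A *m (e l) ^t* ) 0 0 = A k l.
  rewrite /e -rowE !mxE (bigD1 l) //= big1 ?addr0 => [|m ml].
    by rewrite !mxE !eqxx conjC1 mulr1.
  by rewrite !mxE eqxx (negbTE ml) conjC0 mulr0.
have addE (X Y : 'M[C]_1) : (X + Y) 0 0 = X 0 0 + Y 0 0 by rewrite mxE.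
have scaleE z (X : 'M[C]_1) : (z *: X) 0 0 = z * X 0 0 by rewrite mxE.
have q (z : C) :
    0 <= A i i + z^* * A i j + (z * (A i j)^* + z * z^* * A j j).
  have := pA (e i + z *: e j).
  rewrite linearD linearZ /= map_mxD map_mxZ !mulmxDl !mulmxDr.
  rewrite -!scalemxAl -!scalemxAr !addE !scaleE !form Aji.
  by rewrite !mulrA.
have Re_ge (z : C) : 0 <= z -> 0 <= complex.Re z by rewrite lecE => /andP[].
have q1 := Re_ge _ (q 1); have q2 := Re_ge _ (q (-1)).
have q3 := Re_ge _ (q ('i : C)); have q4 := Re_ge _ (q (- 'i)).
move: q1 q2 q3 q4 tr2; case: (A i j) => x y; case: (A i i) => u u'.
case: (A j j) => v v'; rewrite /=.
rewrite !ler_norml => ? ? ? ? ?.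
by split; apply/andP; split; lra.
Qed.

End Psd.

(** * Limits of matrices *)

Section MatrixLimits.
Variable R : realType.

Lemma Re_complexM (x y : R[i]) : complex.Re (x * y) =
  complex.Re x * complex.Re y - complex.Im x * complex.Im y.
Proof. by case: x => ? ?; case: y. Qed.

Lemma Im_complexM (x y : R[i]) : complex.Im (x * y) =
  complex.Re x * complex.Im y + complex.Im x * complex.Re y.
Proof. by case: x => ? ?; case: y. Qed.

Lemma cvg_bigsum (T : Type) (F : set_system T) {FF : Filter F} (I : Type)
    (s : seq I) (f : I -> T -> R) (l : I -> R) :
  (forall i, f i x @[x --> F] --> l i) ->
  \sum_(i <- s) f i x @[x --> F] --> \sum_(i <- s) l i.
Proof.
move=> h; elim: s => [|i s IH].
  rewrite big_nil; under eq_cvg do rewrite big_nil; exact: cvg_cst.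
rewrite big_cons; under eq_cvg do rewrite big_cons.
exact: cvgD.
Qed.

Lemma mx_cvg_mul m n p (B : 'M[R[i]]_(m, n)) (s : nat -> 'M[R[i]]_(n, p)) S :
  mx_cvg s S -> mx_cvg (fun k => B *m s k) (B *m S).
Proof.
move=> h i j; split; rewrite mxE raddf_sum.
- have -> : (fun k => complex.Re ((B *m s k) i j)) = (fun k => \sum_l
    (complex.Re (B i l) * complex.Re (s k l j)
      - complex.Im (B i l) * complex.Im (s k l j))).
    by apply/funext => k; rewrite mxE raddf_sum; apply: eq_bigr => l _; rewrite /= Re_complexM.
  apply: cvg_bigsum => l /=; rewrite Re_complexM; have [h1 h2] := h l j.
  by apply: cvgB; apply: cvgMl_tmp.
have -> : (fun k => complex.Im ((B *m s k) i j)) = (fun k => \sum_l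
    (complex.Re (B i l) * complex.Im (s k l j)
      + complex.Im (B i l) * complex.Re (s k l j))).
  by apply/funext => k; rewrite mxE raddf_sum; apply: eq_bigr => l _; rewrite /= Im_complexM.
apply: cvg_bigsum => l /=; rewrite Im_complexM; have [h1 h2] := h l j.
by apply: cvgD; apply: cvgMl_tmp.
Qed.

Lemma mx_cvg_tr m n (s : nat -> 'M[R[i]]_(m, n)) S :
  mx_cvg s S -> mx_cvg (fun k => (s k)^T) S^T.
Proof.
move=> h i j; have [h1 h2] := h j i.
by split; rewrite mxE; under eq_cvg do rewrite mxE.
Qed.

(** Multiplication on the right reduces to multiplication on the left by transposing. *)
Lemma mx_cvg_conj m n (B : 'M[R[i]]_(m, n)) (D : 'M[R[i]]_(n, m))
    (s : nat -> 'M[R[i]]_n) S :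
  mx_cvg s S -> mx_cvg (fun k => B *m s k *m D) (B *m S *m D).
Proof.
move=> h; have := mx_cvg_tr (mx_cvg_mul D^T (mx_cvg_tr (mx_cvg_mul B h))).
rewrite -trmx_mul trmxK.
by have -> : (fun k => (D^T *m (B *m s k)^T)^T) = (fun k => B *m s k *m D);
  [apply/funext => k; rewrite -trmx_mul trmxK|].
Qed.

End MatrixLimits.

Lemma tr_conj (R : realType) n (B X : 'M[R[i]]_n) : B \is unitarymx ->
  \tr (B *m X *m B ^t* ) = \tr X.
Proof.
move=> uB; rewrite mxtrace_mulC mulmxA -(invmx_unitary uB) mulVmx ?mul1mx //.
exact: unitarymx_unit.
Qed.

Lemma adjoint_if_unitary (R : realType) adj n (A : 'M[R[i]]_n) :
  A \is unitarymx -> adjoint_if adj A \is unitarymx.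
Proof. by rewrite /adjoint_if; case: adj; rewrite ?trmxC_unitary. Qed.

Lemma semi_density_conj (R : realType) n (B A : 'M[R[i]]_n) :
  B \is unitarymx -> semi_density A -> semi_density (B *m A *m B ^t* ).
Proof.
by move=> uB [pA tA]; split; [exact: psdmx_conj | rewrite tr_conj].
Qed.

(** The machine finds [n] and [A] on the oracle tape, so one string [e] serves all of them; this
    uniformity is what makes the final constant independent of the matrices. *)
Lemma lower_computes_conj (R : realType) (U : machine) adj : universal U ->
  exists e : seq bool, forall n (A : 'M[R[i]]_(2 ^ n)) a q nu,
    A \is unitarymx -> encodes a A -> lower_computes U a q nu ->
    let B := adjoint_if adj A in
    lower_computes U a (e ++ q) (B *m nu *m B ^t* ).
Proof.
move=> /(_ (pipe U (compile (main adj) 0)))[e he]; exists e.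
move=> n A a q nu uA [Ar AE ->] [pnu [r [hr1 hr2 hr3 hr4]]] B; subst A.
have uB : B \is unitarymx by apply: adjoint_if_unitary.
split; first exact: psdmx_conj.
exists (fun k => conj_mx adj Ar (r k)); split.
- move=> k; apply/(he _ _ _).2; exact: outputs_conj.
- by move=> k; rewrite conj_mx_val; apply: semi_density_conj.
- move=> k; rewrite !conj_mx_val -mulmxBl -mulmxBr; exact: psdmx_conj.
- have -> : (fun k => mx_val R (conj_mx adj Ar (r k))) =
      (fun k => B *m mx_val R (r k) *m B ^t* ).
    by apply/funext => k; rewrite conj_mx_val.
  exact: mx_cvg_conj.
Qed.

(** * Weights *)

Section Esum.
Variable R : realType.

Lemma subset_esum (T : choiceType) (S S' : set T) (a : T -> \bar R) :
  S `<=` S' -> (\esum_(x in S) a x <= \esum_(x in S') a x)%E.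
Proof.
move=> SS'; apply: le_ereal_sup => _ [X [fX XS] <-]; exists X => //.
by split => //; exact: subset_trans SS'.
Qed.

Lemma le_esumZ (T : choiceType) (S : set T) (a : T -> \bar R) (c : R) :
  0 <= c -> (forall x, 0 <= a x)%E ->
  (\esum_(x in S) (c%:E * a x) <= c%:E * \esum_(x in S) a x)%E.
Proof.
move=> c0 a0; apply: ge_ereal_sup => _ [X [fX XS] <-].
rewrite -ge0_mule_fsumr //; apply: lee_wpmul2l; first by rewrite lee_fin.
by apply: ereal_sup_ubound; exists X.
Qed.

Lemma le_esum_inj (T T' : choiceType) (S : set T) (S' : set T') (e : T -> T')
    (a : T -> \bar R) (b : T' -> \bar R) (c : R) :
  0 <= c -> (forall x, 0 <= b x)%E -> injective e ->
  (forall x, S x -> S' (e x)) -> (forall x, a x <= c%:E * b (e x))%E ->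
  (\esum_(x in S) a x <= c%:E * \esum_(x in S') b x)%E.
Proof.
move=> c0 b0 ie Se ab.
apply: (@le_trans _ _ (\esum_(x in S) (c%:E * b (e x)))%E).
  by apply: le_esum => x _; exact: ab.
apply: (@le_trans _ _ (c%:E * \esum_(x in S) b (e x))%E); first exact: le_esumZ.
apply: lee_wpmul2l; first by rewrite lee_fin.
rewrite -(esum_image S e b); last by move=> x y _ _; exact: ie.
by apply: subset_esum => _ [x Sx <-]; exact: Se.
Qed.

End Esum.

(** * Universal probability and total weight *)

Section Probability.
Variables (R : realType) (U : machine) (a : seq bool).

Lemma univ_prob_ge0 x y : (0 <= univ_prob R U a x y)%E.
Proof.
by apply: esum_ge0 => p _; rewrite lee_fin invr_ge0 exprn_ge0.
Qed.

Lemma lower_prob_ge0 n (S : 'M[R[i]]_(2 ^ n)) y : (0 <= lower_prob U a S y)%E.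
Proof. by apply: esum_ge0 => q _; exact: univ_prob_ge0. Qed.

Lemma kraft y (S : set (seq bool)) :
  (forall p, S p -> exists x, computes U a y p x) ->
  (\esum_(p in S) ((2%:R ^- size p)%:E : \bar R) <= 1)%E.
Proof.
move=> hS; apply: ge_ereal_sup => _ [X [fX XS] <-].
rewrite fsbig_finite //= sumEFin lee_fin.
apply: (@kraft_fin _ (\max_(p <- fset_set X) size p)).
- by move=> p hp; exact: (@leq_bigmax_seq _ _ xpredT size).
- exact: fset_uniq.
have memX p : p \in fset_set X -> X p by rewrite in_fset_set // => /set_mem.
move=> p q /memX/XS/hS[x hx] /memX/XS/hS[x' hx'].
by move=> /prefixP[s e]; move: hx'; rewrite e => /(computes_prefix hx)[-> _];
  rewrite cats0.
Qed.

(** Written out, this is a sum over triples (nu, q, p). Since p determines the triple, it can be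
    reindexed by the halting programs p, where Kraft's inequality applies. *)
Lemma sum_lower_prob n y (J : {fset 'M[R[i]]_(2 ^ n)}) :
  (\sum_(nu <- J) lower_prob U a nu y <= 1)%E.
Proof.
have -> : (\sum_(nu <- J) lower_prob U a nu y =
    \esum_(nu in [set` J]) lower_prob U a nu y)%E.
  rewrite esum_fset // => [|nu _]; last exact: lower_prob_ge0.
  by rewrite fsbig_finite //= set_fsetK.
pose LC nu : set (seq bool) := fun q => @lower_computes R U a n q nu.
pose CP q : set (seq bool) := fun p => computes U a y p q.
pose f (p : seq bool) : \bar R := (2%:R ^- size p)%:E.
have f0 p : (0 <= f p)%E by rewrite lee_fin invr_ge0 exprn_ge0.
rewrite (eq_esum (b := fun nu => \esum_(k in LC nu `*`` CP) f k.2)); last first.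
  by move=> nu _; rewrite -(esum_esum (a := fun _ p => f p)).
rewrite (esum_esum (a := fun _ k => f k.2)) //.
rewrite -(esum_image _ (fun k => k.2.2) f).
  apply: (@kraft y) => _ [[nu [q p]] /= [_ [_ h]] <-].
  by exists q.
move=> [nu [q p]] [nu' [q' p']]; move=> /set_mem[/= _ [/= hq hp]] /set_mem[/= _ [/= hq' hp']] /= e.
rewrite -{}e -(cats0 p) in hp' *.
have [_ e] := computes_prefix hp hp'; rewrite -e in hq' *.
by rewrite (lower_computes_inj hq hq') cats0.
Qed.

(** In [universal_test], [fine] would turn an infinite weight into 0; the bound by 1 excludes
    this. *)
Lemma lower_prob_fin n (S : 'M[R[i]]_(2 ^ n)) y :
  lower_prob U a S y \is a fin_num.
Proof.
rewrite ge0_fin_numE ?lower_prob_ge0 //; apply: (@le_lt_trans _ _ 1%E); last first.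
  by rewrite ltry.
by have := sum_lower_prob y [fset S]%fset; rewrite big_seq_fset1.
Qed.

Lemma sum_fine_lower_prob n y (J : {fset 'M[R[i]]_(2 ^ n)}) :
  \sum_(nu <- J) fine (lower_prob U a nu y) <= 1.
Proof.
rewrite -lee_fin -sumEFin.
under eq_bigr do rewrite fineK ?lower_prob_fin //.
exact: sum_lower_prob.
Qed.

Lemma le_lower_prob n y e (c : R) (S S' : 'M[R[i]]_(2 ^ n)) : 0 <= c ->
  (forall q, univ_prob R U a q y <= c%:E * univ_prob R U a (e ++ q) y)%E ->
  (forall q, lower_computes U a q S -> lower_computes U a (e ++ q) S') ->
  fine (lower_prob U a S y) <= c * fine (lower_prob U a S' y).
Proof.
move=> c0 hu hl; rewrite -lee_fin EFinM !fineK ?lower_prob_fin //.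
apply: (le_esum_inj (e := cat e)) => //.
- by move=> q; exact: univ_prob_ge0.
- by move=> q q' /eqP; rewrite eqseq_cat // eqxx => /eqP.
Qed.

End Probability.

(** If [U] simulates, after the prefix [e2], the machine that writes [e] before the output of [U],
    then a program for q becomes one for e ++ q that is longer by [size e2]. Hence c is 2 to that
    power. *)
Lemma univ_prob_prepend (R : realType) (U : machine) (e : seq bool) :
  universal U -> exists2 c : R, 0 < c & forall a q y,
    (univ_prob R U a q y <= c%:E * univ_prob R U a (e ++ q) y)%E.
Proof.
move=> hU; have [T hT] := exists_prepend U e.
have [e2 he2] := hU T; exists (2%:R ^+ size e2); first by rewrite exprn_gt0.
move=> a q y.
apply: (@le_esum_inj _ _ _ _ _ (cat e2) _ (fun p => (2%:R ^- size p)%:E)).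
- by rewrite exprn_ge0.
- by move=> p; rewrite lee_fin invr_ge0 exprn_ge0.
- by move=> p p' /eqP; rewrite eqseq_cat // eqxx => /eqP.
- by move=> p /hT /(proj1 (he2 a y p) _).
- move=> p; rewrite -EFinM lee_fin size_cat exprD invfM mulrA divff ?mul1r //.
Qed.

(** * Unordered sums and the universal test *)

Section UnorderedSums.
Variables (R : realType) (I : choiceType).
Implicit Types x : I -> R^o.
Local Notation psum := (@summability.partial_sum I _).
Local Notation totally := (@summability.totally I).

Lemma partial_sumE x (J : {fset I}) : psum x J = \sum_(i <- J) x i.
Proof. by rewrite /summability.partial_sum big_seq_fsetE. Qed.

Lemma partial_sum_cvg_ge0 x (M : R) : (forall i, 0 <= x i) ->
  (forall J : {fset I}, \sum_(i <- J) x i <= M) ->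
  psum x @ totally --> (sup (range (psum x)) : R^o).
Proof.
move=> x0 xM; set s := sup _.
have hs : has_sup (range (psum x)).
  split; first by exists (psum x fset0), fset0.
  by exists M => _ [J _ <-]; rewrite partial_sumE.
have ub J : psum x J <= s by apply: ub_le_sup; [exact: hs.2 | exists J].
apply/cvgrPdist_le => e e0.
have [_ [J0 _ <-] hJ0] := sup_adherent e0 hs.
exists J0 => // J /= hJ; rewrite ger0_norm ?subr_ge0 //.
suff : psum x J0 <= psum x J by move: hJ0; rewrite -/s; lra.
rewrite !partial_sumE (big_fsetID _ (fun i => i \in J0) J) /=.
have -> : [fset i in J | i \in J0]%fset = J0.
  apply/fsetP => i; rewrite !inE /=; apply/andP/idP => [[]//|h].
  by split => //; exact: (fsubsetP hJ).
by rewrite lerDl; apply: sumr_ge0.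
Qed.

Lemma partial_sum_cvg x (M : R) :
  (forall J : {fset I}, \sum_(i <- J) `|x i| <= M) ->
  psum x @ totally --> summability.sum x.
Proof.
move=> xM; have h1 := partial_sum_cvg_ge0 (fun i => normr_ge0 (x i)) xM.
have x0 i : 0 <= `|x i| + x i by have := ler_norm (- x i); rewrite normrN; lra.
have x2 (J : {fset I}) : \sum_(i <- J) (`|x i| + x i) <= 2%:R * M.
  apply: (@le_trans _ _ (\sum_(i <- J) 2%:R * `|x i|)).
    by apply: ler_sum => i _; have := ler_norm (x i); lra.
  by rewrite -mulr_sumr ler_wpM2l.
have h2 := partial_sum_cvg_ge0 x0 x2.
(* [summability.sum x] unfolds to the limit of the partial sums, so their mere convergence suffices;
   it follows by writing x as a difference of two nonnegative families. *)
suff : cvg (psum x @ totally) by [].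
have -> : psum x = psum (fun i => `|x i| + x i) - psum (fun i => `|x i|).
  apply/funext => J; rewrite !fctE !partial_sumE -sumrB.
  by apply: eq_bigr => i _; rewrite addrC addKr.
by apply/cvg_ex; eexists; apply: cvgB h2 h1.
Qed.

Lemma partial_sum_le x (l : R) (J : {fset I}) : (forall i, 0 <= x i) ->
  psum x @ totally --> (l : R^o) -> \sum_(i <- J) x i <= l.
Proof.
move=> x0 h; rewrite -partial_sumE.
have hc : cvg (psum x @ totally) by apply/cvg_ex; exists l.
rewrite -(cvg_lim (@norm_hausdorff _ R^o) h).
apply: limr_ge => //; exists J => // K /= hK.
rewrite !partial_sumE (big_fsetID _ (fun i => i \in J) K) /=.
have -> : [fset i in K | i \in J]%fset = J.
  apply/fsetP => i; rewrite !inE /=; apply/andP/idP => [[]//|hi].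
  by split => //; exact: (fsubsetP hK).
by rewrite lerDl; apply: sumr_ge0.
Qed.

End UnorderedSums.

Lemma cvg_entry_le1 (R : realType) (u : nat -> R) (l : R) :
  (forall k, `|u k| <= 1) -> u @ \oo --> l -> `|l| <= 1.
Proof.
move=> hu /cvg_norm h; rewrite -(cvg_lim (@norm_hausdorff _ R^o) h) //.
by apply: limr_le; [apply/cvg_ex; exists `|l| | exact: nearW].
Qed.

Lemma Re_tr_mul (R : realType) n (X Y : 'M[R[i]]_n) :
  complex.Re (\tr (X *m Y)) = \sum_i \sum_j
    (complex.Re (X i j) * complex.Re (Y j i) -
     complex.Im (X i j) * complex.Im (Y j i)).
Proof.
rewrite raddf_sum; apply: eq_bigr => i _; rewrite /= mxE raddf_sum.
by apply: eq_bigr => j _; rewrite /= Re_complexM.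
Qed.

(** * Trace of the universal test as a convergent sum *)

Section UniversalTest.
Variables (R : realType) (U : machine) (a : seq bool) (n : nat).
Implicit Types (nu rho sigma : 'M[R[i]]_(2 ^ n)).
Local Notation psum := (summability.partial_sum).
Local Notation totally := (@summability.totally _).

(** A lower computable matrix is a limit of semi-density matrices, whose entries are bounded by
    their trace. *)
Lemma test_entry rho nu i j : tests U a rho nu ->
  `|complex.Re (nu i j)| <= 1 /\ `|complex.Im (nu i j)| <= 1.
Proof.
move=> [[q [_ [r [_ hr _ hc]]]] _]; have [c1 c2] := hc i j.
have h k : `|complex.Re (mx_val R (r k) i j)| <= 1 /\
    `|complex.Im (mx_val R (r k) i j)| <= 1.
  have [p t] := hr k; have [h1 h2] := psdmx_entry i j p.
  have t1 : complex.Re (\tr (mx_val R (r k))) <= 1.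
    by move: t; rewrite lecE => /andP[].
  by split; [exact: le_trans h1 t1 | exact: le_trans h2 t1].
by split; [apply: cvg_entry_le1 c1 | apply: cvg_entry_le1 c2] => k;
  have [] := h k.
Qed.

Lemma test_psd rho nu : tests U a rho nu -> psdmx nu.
Proof. by move=> [[q []]]. Qed.

Definition weight rho nu : R :=
  if nu \in tests U a rho then fine (lower_prob U a nu (nat_code n)) else 0.

Lemma weight_ge0 rho nu : 0 <= weight rho nu.
Proof.
by rewrite /weight; case: ifP => // _; apply: fine_ge0; exact: lower_prob_ge0.
Qed.

Lemma sum_weight rho (J : {fset 'M[R[i]]_(2 ^ n)}) :
  \sum_(nu <- J) weight rho nu <= 1.
Proof.
apply: le_trans (sum_fine_lower_prob U a (nat_code n) J).
apply: ler_sum => nu _; rewrite /weight; case: ifP => // _.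
by apply: fine_ge0; exact: lower_prob_ge0.
Qed.

(** The trace is a finite real-linear combination of real and imaginary parts of entries, so it
    commutes with the entrywise sum once that is known to converge. *)
Lemma universal_test_cvg rho sigma :
  psum (fun nu => weight rho nu * complex.Re (\tr (nu *m sigma)) : R^o)
    @ totally -->
  (complex.Re (\tr (universal_test U a rho *m sigma)) : R^o).
Proof.
pose F nu : 'M[R[i]]_(2 ^ n) := (weight rho nu)%:C%C *: nu.
have FE : (fun nu => if nu \in tests U a rho
    then (fine (lower_prob U a nu (nat_code n)))%:C%C *: nu else 0) = F.
  by apply/funext => nu; rewrite /F /weight; case: ifP; rewrite ?scale0r.
have ReF nu i j : complex.Re (F nu i j) = weight rho nu * complex.Re (nu i j).
  by rewrite mxE Re_complexM /= mul0r subr0.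
have ImF nu i j : complex.Im (F nu i j) = weight rho nu * complex.Im (nu i j).
  by rewrite mxE Im_complexM /= mul0r addr0.
have bnd (x : 'M[R[i]]_(2 ^ n) -> R) :
    (forall nu, tests U a rho nu -> `|x nu| <= 1) ->
    forall J : {fset 'M[R[i]]_(2 ^ n)},
    \sum_(nu <- J) `|weight rho nu * x nu| <= 1.
  move=> hx J; apply: le_trans (sum_weight rho J).
  apply: ler_sum => nu _; rewrite normrM (ger0_norm (weight_ge0 _ _)).
  rewrite /weight; case: ifP => [/set_mem h|_]; last by rewrite mul0r.
  by apply: ler_piMr (hx _ h); apply: fine_ge0; exact: lower_prob_ge0.
have cRe i j : psum (fun nu => complex.Re (F nu i j) : R^o) @ totally -->
    (complex.Re (universal_test U a rho i j) : R^o).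
  rewrite /universal_test FE mxE; apply: (@partial_sum_cvg _ _ _ 1) => J.
  under eq_bigr do rewrite ReF.
  by apply: bnd => nu h; have [] := test_entry i j h.
have cIm i j : psum (fun nu => complex.Im (F nu i j) : R^o) @ totally -->
    (complex.Im (universal_test U a rho i j) : R^o).
  rewrite /universal_test FE mxE; apply: (@partial_sum_cvg _ _ _ 1) => J.
  under eq_bigr do rewrite ImF.
  by apply: bnd => nu h; have [] := test_entry i j h.
have -> : psum (fun nu => weight rho nu * complex.Re (\tr (nu *m sigma)) : R^o)
  = (fun J => \sum_i \sum_j
    (psum (fun nu => complex.Re (F nu i j) : R^o) J * complex.Re (sigma j i) -
     psum (fun nu => complex.Im (F nu i j) : R^o) J * complex.Im (sigma j i))).
  apply/funext => J; rewrite partial_sumE.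
  under [RHS]eq_bigr => i _ do under eq_bigr => j _ do
    rewrite !partial_sumE !mulr_suml -sumrB.
  under [RHS]eq_bigr => i _ do rewrite exchange_big /=.
  rewrite [RHS]exchange_big /=; apply: eq_bigr => nu _.
  rewrite Re_tr_mul mulr_sumr; apply: eq_bigr => i _.
  rewrite mulr_sumr; apply: eq_bigr => j _.
  by rewrite ReF ImF; ring.
rewrite Re_tr_mul; apply: cvg_bigsum => i; apply: cvg_bigsum => j.
by apply: cvgB; apply: cvgMr_tmp.
Qed.

(** A finite partial sum for [rho] is compared with the partial sum for [rho'] over its image under
    [f], which stays below the full sum because all terms are nonnegative. The lower bound 0 is what
    the logarithm requires. *)
Lemma universal_test_le (f : 'M[R[i]]_(2 ^ n) -> 'M[R[i]]_(2 ^ n)) (c : R)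
    sigma rho sigma' rho' :
  0 <= c -> injective f -> psdmx sigma -> psdmx sigma' ->
  (forall nu, tests U a rho nu -> tests U a rho' (f nu)) ->
  (forall nu, \tr (f nu *m sigma') = \tr (nu *m sigma)) ->
  (forall nu, tests U a rho nu -> fine (lower_prob U a nu (nat_code n)) <=
     c * fine (lower_prob U a (f nu) (nat_code n))) ->
  0 <= complex.Re (\tr (universal_test U a rho *m sigma)) <=
  c * complex.Re (\tr (universal_test U a rho' *m sigma')).
Proof.
move=> c0 fI ps ps' ft ftr fl.
have pos rh sg nu : psdmx sg ->
    0 <= weight rh nu * complex.Re (\tr (nu *m sg)).
  move=> psg; rewrite /weight; case: ifP => [/set_mem h|_]; last by rewrite mul0r.
  apply: mulr_ge0; first by apply: fine_ge0; exact: lower_prob_ge0.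
  have := psdmx_tr_mul (test_psd h) psg.
  by rewrite lecE => /andP[].
have cX := @universal_test_cvg rho sigma.
have cY := @universal_test_cvg rho' sigma'.
apply/andP; split.
  have := partial_sum_le fset0 (fun nu => pos rho sigma nu ps) cX.
  by rewrite big_seq_fset0.
rewrite -(cvg_lim (@norm_hausdorff _ R^o) cX).
apply: limr_le; first by apply/cvg_ex; eexists; exact: cX.
exists fset0 => // J _ /=; rewrite partial_sumE.
apply: (@le_trans _ _ (\sum_(nu <- J) c * (weight rho' (f nu) *
    complex.Re (\tr (f nu *m sigma'))))).
  apply: ler_sum => nu _; rewrite ftr mulrA; rewrite {1}/weight.
  case: ifP => [/set_mem h|_]; last first.
    (* Outside the tests of [rho] the left-hand weight vanishes, whereas the right-hand one is only
       known to be nonnegative. *)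
    rewrite mul0r -ftr -mulrA; apply: mulr_ge0 => //; exact: pos.
  have ht := ft _ h; apply: ler_wpM2r.
    by have := psdmx_tr_mul (test_psd h) ps; rewrite lecE => /andP[].
  by rewrite /weight mem_set //; exact: fl.
rewrite -mulr_sumr; apply: ler_wpM2l => //.
have := partial_sum_le (f @` J)%fset (fun nu => pos rho' sigma' nu ps') cY.
by rewrite big_imfset //= => x y _ _; exact: fI.
Qed.

End UniversalTest.

(** * Comparing deficiencies *)

Lemma deficiency_le (R : realType) (U : machine) a n
    (sigma rho sigma' rho' : 'M[R[i]]_(2 ^ n)) (c : R) : 0 < c ->
  0 <= complex.Re (\tr (universal_test U a rho *m sigma)) <=
    c * complex.Re (\tr (universal_test U a rho' *m sigma')) ->
  (deficiency U a sigma rho <=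
   deficiency U a sigma' rho' + (ln c * (ln 2)^-1)%:E)%E.
Proof.
rewrite /deficiency; set x := complex.Re _; set y := complex.Re _.
move=> c0 /andP[x0 xy].
have k0 : 0 < ((ln 2)^-1)%R :> R by rewrite invr_gt0 ln_gt0 // ltr1n.
(* For x = 0 the left-hand side is -oo; otherwise y is positive too and both logarithms are
   finite. *)
have [->|xn0] := eqVneq x 0.
  by rewrite le0_lneNy // mulNyr gtr0_sg // mul1e leNye.
have xp : 0 < x by rewrite lt_neqAle eq_sym xn0.
have yp : 0 < y by rewrite -(pmulr_rgt0 _ c0); exact: lt_le_trans xy.
rewrite !lne_EFin // -!EFinM -EFinD lee_fin -mulrDl ler_pM2r //.
by rewrite addrC -lnM ?posrE // ler_ln ?posrE // mulr_gt0.
Qed.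

Lemma deficiency_conj (R : realType) (U : machine) adj : universal U ->
  exists c : R, forall n (A : 'M[R[i]]_(2 ^ n)) a,
    A \is unitarymx -> encodes a A -> forall sigma rho,
    semi_density sigma -> forall B, B = adjoint_if adj A ->
    (deficiency U a sigma rho <=
     deficiency U a (B *m sigma *m B ^t* ) (B *m rho *m B ^t* ) + c%:E)%E.
Proof.
move=> hU; have [e he] := lower_computes_conj R adj hU.
have [c c0 hc] := univ_prob_prepend R e hU.
exists (ln c * (ln 2)^-1)%R => n A a uA encA sigma rho [ps _] B BE.
have uB : B \is unitarymx by rewrite BE; exact: adjoint_if_unitary.
have BB : B ^t* *m B = 1%:M.
  by rewrite -(invmx_unitary uB) mulVmx // unitarymx_unit.
(* Used with nu and rho, this carries tests to tests; used with nu and sigma, it preserves the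
   traces that are being summed. *)
have trE X Y : \tr (B *m X *m B ^t* *m (B *m Y *m B ^t* )) = \tr (X *m Y).
  rewrite -(tr_conj (X *m Y) uB); congr (\tr _).
  by rewrite !mulmxA -[X in X *m Y *m _]mulmxA BB mulmx1.
apply: deficiency_le (c0) _.
apply: (universal_test_le (f := fun nu => B *m nu *m B ^t* )).
- exact: ltW.
- move=> x y /(congr1 (fun z => B ^t* *m z *m B)).
  by rewrite !mulmxA BB !mul1mx -!mulmxA BB !mulmx1.
- exact: ps.
- exact: psdmx_conj.
- move=> nu [[q hq] ht]; split; last by rewrite trE.
  by exists (e ++ q); rewrite BE; exact: he.
- by move=> nu; exact: trE.
- move=> nu _; apply: (le_lower_prob (ltW c0) (hc a ^~ _)).
  by move=> q hq; rewrite BE; exact: he.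
Qed.

Theorem theorem2 (R : realType) (U : machine) (U_universal : universal U) :
  exists c : R, forall (n : nat) (A : 'M[R[i]]_(2 ^ n)) (a : seq bool),
    elementary A -> A \is unitarymx -> encodes a A ->
    forall sigma rho : 'M[R[i]]_(2 ^ n),
      semi_density sigma -> semi_density rho ->
      (deficiency U a (A *m sigma *m A ^t* ) (A *m rho *m A ^t* )
         <= deficiency U a sigma rho + c%:E)%E /\
      (deficiency U a sigma rho
         <= deficiency U a (A *m sigma *m A ^t* ) (A *m rho *m A ^t* )
            + c%:E)%E.
Proof.
have [c1 h1] := deficiency_conj R false U_universal.
have [c2 h2] := deficiency_conj R true U_universal.
exists (Num.max c1 c2) => n A a _ uA encA sigma rho hs hr.
have AA : A ^t* *m A = 1%:M.
  by rewrite -(invmx_unitary uA) mulVmx // unitarymx_unit.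
(* Conjugation by A^* undoes conjugation by A, so the bound for A^*, applied to the conjugated
   matrices, is the first inequality. *)
have K (X : 'M[R[i]]_(2 ^ n)) :
    A ^t* *m (A *m X *m A ^t* ) *m A ^t* ^t* = X.
  by rewrite trmxCK !mulmxA AA mul1mx -mulmxA AA mulmx1.
split.
  have := h2 n A a uA encA _ (A *m rho *m A ^t* )
    (semi_density_conj uA hs) _ erefl.
  rewrite /= !K => /le_trans; apply.
  by rewrite leeD2l // lee_fin le_max lexx orbT.
have := h1 n A a uA encA _ rho hs _ erefl => /le_trans; apply.
by rewrite leeD2l // lee_fin le_max lexx.
Qed.
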